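(* Let $D\ge1$, $p>0$, $b\ge 1$ an integer, and $u,v\in\mathbb{R}^D$ nonzero. Let $(i^*_u,t^*_u)$ and $(i^*_v,t^*_v)$ be the GCWS outputs for $u$ and $v$ computed with shared random numbers (as described in the context). Let $g$ be a random function from $\{1,\dots,2D\}\times\mathbb{Z}$ to $\{0,1,\dots,2^b-1\}$ whose values $g(x)$, $x\in\{1,\dots,2D\}\times\mathbb{Z}$, are independent and uniformly distributed, with $g$ independent of the GCWS randomness, and write $(i^*,t^* )_b=g(i^*,t^* )$. Then $$P\big[(i^*_u,t^*_u)_b=(i^*_v,t^*_v)_b\big]=\textit{pGMM}(u,v;p)+\frac{1}{2^b}\big\{1-\textit{pGMM}(u,v;p)\big\}.$$
   Context: Sign-splitting transformation: for $u\in\mathbb{R}^D$, define $\tilde u\in\mathbb{R}^{2D}$ by, for each $i$: if $u_i>0$ then $\tilde u_{2i-1}=u_i,\tilde u_{2i}=0$; if $u_i\le 0$ then $\tilde u_{2i-1}=0,\tilde u_{2i}=-u_i$. $\textit{pGMM}(u,v;p)=\sum_{i=1}^{2D}(\min\{\tilde u_i,\tilde v_i\})^p/\sum_{i=1}^{2D}(\max\{\tilde u_i,\tilde v_i\})^p$. GCWS procedure: draw independently for $i=1,\dots,2D$: $r_i\sim\mathrm{Gamma}(2,1)$, $c_i\sim\mathrm{Gamma}(2,1)$, $\beta_i\sim\mathrm{Uniform}(0,1)$. For each $i$ with $\tilde u_i>0$ set $t_i=\lfloor p\log(\tilde u_i)/r_i+\beta_i\rfloor$ and $a_i=\log(c_i)-r_i(t_i+1-\beta_i)$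 (indices with $\tilde u_i=0$ are skipped). Output $i^*=\arg\min_i a_i$, $t^*=t_{i^*}$. The same $r_i,c_i,\beta_i$ are used for $v$. *)

(* Defs.v *)
From HB Require Import structures.
From mathcomp Require Import all_boot all_order all_algebra.
From mathcomp Require Import all_classical all_reals all_analysis.
From mathcomp Require Import uniform_distribution.

Set Implicit Arguments.
Unset Strict Implicit.
Unset Printing Implicit Defensive.
Import Order.TTheory GRing.Theory Num.Theory.
Local Open Scope classical_set_scope.
Local Open Scope ring_scope.

(* Sign-splitting.  Coordinates are 0-based: u : 'I_D -> R, and the
   split vector is indexed by 'I_(2*D).  The 0-based index 2i
   (paper: 2i+1 = 2(i+1)-1) carries the positive part of u_i, the
   0-based index 2i+1 (paper: 2(i+1)) carries -u_i when u_i <= 0.     *)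

Lemma half_ord_proof (D : nat) (j : 'I_(2 * D)) : (j %/ 2 < D)%N.
Proof. case: j => /= j; rewrite ltn_divLR // => H; by rewrite mulnC. Qed.

Definition half_ord (D : nat) (j : 'I_(2 * D)) : 'I_D :=
  Ordinal (half_ord_proof j).

Definition sign_split (R : realType) (D : nat) (u : 'I_D -> R)
    (j : 'I_(2 * D)) : R :=
  let x := u (half_ord j) in
  if ~~ odd j then (if 0 < x then x else 0)
  else (if 0 < x then 0 else - x).

Definition pGMM (R : realType) (D : nat) (u v : 'I_D -> R) (p : R) : R :=
  (\sum_(j < 2 * D) (Order.min (sign_split u j) (sign_split v j)) `^ p) /
  (\sum_(j < 2 * D) (Order.max (sign_split u j) (sign_split v j)) `^ p).

Definition gcws_t (R : realType) (D : nat) (p : R) (u : 'I_D -> R)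
    (r beta : 'I_(2 * D) -> R) (j : 'I_(2 * D)) : int :=
  Num.floor (p * ln (sign_split u j) / r j + beta j).

Definition gcws_a (R : realType) (D : nat) (p : R) (u : 'I_D -> R)
    (r c beta : 'I_(2 * D) -> R) (j : 'I_(2 * D)) : R :=
  ln (c j) - r j * ((gcws_t p u r beta j)%:~R + 1 - beta j).

(* i* = an index minimizing a_i among the indices with u~_i > 0 (ties,
   which have probability zero, are broken by [pick]); the output is
   (i*, t_{i*}).  [None] only when u~ has no positive entry (u = 0). *)
Definition gcws (R : realType) (D : nat) (p : R) (u : 'I_D -> R)
    (r c beta : 'I_(2 * D) -> R) : option ('I_(2 * D) * int) :=
  let a := gcws_a p u r c beta in
  omap (fun i => (i, gcws_t p u r beta i))
    [pick i | (0 < sign_split u i) &&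
              [forall k, (0 < sign_split u k) ==> (a i <= a k)]].

Definition gamma21_pdf (R : realType) (x : R) : R :=
  if 0 < x then x * expR (- x) else 0.

Definition mutually_independent (d : measure_display) (T : measurableType d)
    (R : realType) (P : probability T R) (I : eqType) (X : I -> T -> R) :=
  forall (J : seq I) (A : I -> set R),
    uniq J -> (forall j, measurable (A j)) ->
    P (\bigcap_(j in [set j | j \in J]) (X j @^-1` A j)) =
    (\big[*%E/1%E]_(j <- J) P (X j @^-1` A j))%E.

(* index set of all the random quantities: (j, 0) ~ r_j, (j, 1) ~ c_j,
   (j, 2) ~ beta_j, and inr x ~ g(x) *)
Definition gcws_index (D : nat) : eqType :=
  (('I_(2 * D) * 'I_3) + ('I_(2 * D) * int))%type.

Definition gcws_family (d : measure_display) (T : measurableType d)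
    (R : realType) (D b : nat) (r c beta : 'I_(2 * D) -> T -> R)
    (g : T -> 'I_(2 * D) * int -> 'I_(2 ^ b))
    (k : gcws_index D) : T -> R :=
  match k with
  | inl (j, m) => if val m == 0%N then r j
                  else if val m == 1%N then c j else beta j
  | inr x => fun w => ((g w x : nat)%:R : R)
  end.

(* Main.v *)
(* On each coordinate, write x = p log s and let z = r (t + 1 - beta).  The offset
   z - x is uniform on ]0, r] given r ~ Gamma(2,1), so z - x and r - (z - x) are
   independent Exp(1) variables.  Hence c e^(- z) = e^a is exponential of rate s^p,
   and lowering x by delta leaves t unchanged with probability e^(- delta),
   independently of e^a.  Let M and m be the coordinatewise maximum and minimum of
   the split vectors.  Keys decrease in s, so the outputs for u and v coincide iff
   the index i of the smallest key of M satisfies t_i(m) = t_i(M).  This race of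
   independent exponentials is won by i with probability M_i^p / sum_k M_k^p, and
   the extra condition contributes the independent factor (m_i / M_i)^p; summing
   over i gives pGMM.  When the outputs differ, g identifies them with probability
   2^-b. *)

Require Import Defs.
From HB Require Import structures.
From mathcomp Require Import all_boot all_order all_algebra.
From mathcomp Require Import all_classical all_reals all_analysis.
From mathcomp Require Import uniform_distribution measurable_realfun.
From mathcomp Require Import ring lra.
Set Implicit Arguments.
Unset Strict Implicit.
Unset Printing Implicit Defensive.
Import Order.TTheory GRing.Theory Num.Theory.
Import numFieldNormedType.Exports.
Local Open Scope classical_set_scope.
Local Open Scope ring_scope.

(** Independence is given only for preimages under single real variables, while the argument
    conditions on whole groups of them and evaluates [g] at random points. Both are reached through
    sigma-algebras generated by finitely many variables: events over disjoint lists of indices are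
    independent, and by Tonelli an integrand [f (w, w)] whose two arguments are read through
    disjoint lists decouples into [f (w, w')]. The laws make [r] and [c] positive only almost
    surely, and ties may occur, so a win is defined with positivity and strict inequalities built
    in. The winning probabilities add up to 1, which shows at once that all excluded draws form a
    null set. Comparison with [M] works because at every index one of the two split vectors equals
    [M] and the other [m]. The shift is [dlt = p ln M_i - p ln m_i], chosen so that
    [e^(- dlt) M_i^p = m_i^p]. *)

Lemma bigcap_mem_cons (I : eqType) (T : Type) (i : I) (J : seq I)
    (F : I -> set T) :
  \bigcap_(j in [set j | j \in i :: J]) F j =
  F i `&` \bigcap_(j in [set j | j \in J]) F j.
Proof.
apply/seteqP; split=> [w h|w [Fi h] j /=].
  by split=> [|j /= jJ]; apply: h; rewrite /= inE ?eqxx// jJ orbT.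
by rewrite inE => /orP[/eqP->//|]; exact: h.
Qed.

(** * Independence of sigma-algebras generated by disjoint groups of variables *)

Section independence.
Context (R : realType) (d : measure_display) (T : measurableType d)
  (P : probability T R).

Definition independent_systems (G H : set (set T)) :=
  forall A B, G A -> H B -> P (A `&` B) = (P A * P B)%E.

Lemma independent_systemsC G H :
  independent_systems G H -> independent_systems H G.
Proof. by move=> i A B HA GB; rewrite setIC i// muleC. Qed.

(** For fixed [B] in [H], the maps [A |-> P (A & B)] and [A |-> P A * P B] are finite measures that
    agree on the pi-system [G], hence on the sigma-algebra it generates. *)
Lemma independent_g_sigma_l G H : G setT -> setI_closed G ->
  G `<=` measurable -> H `<=` measurable -> independent_systems G H ->
  independent_systems <<s G >> H.
Proof.
move=> GT GI Gm Hm GH A B sA HB.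
have mB := Hm _ HB.
have PB0 : 0 <= fine (P B) by rewrite fine_ge0.
have PBE : (fine (P B))%:E = P B by rewrite fineK// fin_num_measure.
have mscaleE C : mscale (NngNum PB0) P C = (P C * P B)%E.
  by rewrite muleC -[X in (X * _)%E]PBE.
rewrite -mscaleE.
apply: (g_sigma_algebra_measure_unique G Gm (fun=> setT) (fun=> GT) _
  (mrestr P mB) (mscale (NngNum PB0) P)) sA => //.
- by rewrite bigcup_const//; exists 0%N.
- by move=> C GC; rewrite [RHS]mscaleE; exact: GH.
- by move=> _; rewrite -ge0_fin_numE// fin_num_measure.
Qed.

Lemma g_sigma_measurable (G : set (set T)) : G `<=` measurable ->
  <<s G >> `<=` (measurable : set (set T)).
Proof.
move=> Gm; apply: smallest_sub => //; split => //.
- by move=> A mA; rewrite setTD; exact: measurableC.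
- by move=> F mF; apply: bigcup_measurable.
Qed.

Lemma independent_g_sigma G H : G setT -> setI_closed G -> G `<=` measurable ->
  H setT -> setI_closed H -> H `<=` measurable ->
  independent_systems G H -> independent_systems <<s G >> <<s H >>.
Proof.
move=> GT GI Gm HT HI Hm GH.
apply: independent_g_sigma_l => //; first exact: g_sigma_measurable.
apply: independent_systemsC; apply: independent_g_sigma_l => //.
exact: independent_systemsC.
Qed.

(** The law of [(X, Y)] agrees with the product of the marginal laws on rectangles, so it is the
    product measure; Tonelli applies there and the result is pulled back to [T]. *)
Lemma fubini_independent (d1 d2 : measure_display) (T1 : measurableType d1)
    (T2 : measurableType d2) (X : T -> T1) (Y : T -> T2)
    (f : T1 * T2 -> \bar R) :
  measurable_fun setT X -> measurable_fun setT Y ->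
  (forall A B, measurable A -> measurable B ->
    P (X @^-1` A `&` Y @^-1` B) = (P (X @^-1` A) * P (Y @^-1` B))%E) ->
  measurable_fun setT f -> (forall x, 0 <= f x)%E ->
  (\int[P]_w f (X w, Y w) = \int[P]_w \int[P]_w' f (X w, Y w'))%E.
Proof.
move=> mX mY XY mf f0.
have mXY : measurable_fun setT (fun w : T => (X w, Y w)).
  exact: measurable_fun_pair.
pose X' : {mfun T >-> T1} := HB.pack X (isMeasurableFun.Build _ _ _ _ _ mX).
pose Y' : {mfun T >-> T2} := HB.pack Y (isMeasurableFun.Build _ _ _ _ _ mY).
pose XY' : {mfun T >-> (T1 * T2)%type} :=
  HB.pack (fun w : T => (X w, Y w)) (isMeasurableFun.Build _ _ _ _ _ mXY).
transitivity (\int[distribution P XY']_x f x)%E.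
  by rewrite ge0_integral_distribution.
rewrite (eq_measure_integral (distribution P X' \x distribution P Y')%E); last first.
  move=> A mA _; exact/esym/product_measure_unique.
rewrite fubini_tonelli1// ge0_integral_distribution//.
- apply: eq_integral => w _ /=; rewrite /fubini_F ge0_integral_distribution//.
  by apply: measurableT_comp => //; exact: measurable_pair1.
- exact: measurable_fun_fubini_tonelli_F.
- by move=> w; apply: integral_ge0.
Qed.

Section cylinders.
Context (I : eqType) (X : I -> T -> R).
Hypothesis mX : forall i, measurable_fun setT (X i).
Hypothesis iX : mutually_independent P X.

(** For a fixed finite [J] these events form a pi-system generating the sigma-algebra of the
    variables indexed by [J], and they are exactly the events that [mutually_independent] speaks
    about. *)
Definition cylinders (J : seq I) : set (set T) :=
  [set C | exists2 A : I -> set R, (forall j, measurable (A j)) &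
     C = \bigcap_(j in [set j | j \in J]) (X j @^-1` A j)].

Lemma cylindersT J : cylinders J setT.
Proof. by exists (fun=> setT) => //; apply/seteqP; split. Qed.

Lemma cylindersI J : setI_closed (cylinders J).
Proof.
move=> _ _ [A mA ->] [B mB ->]; exists (fun j => A j `&` B j).
  by move=> j; exact: measurableI.
by rewrite -bigcapI.
Qed.

Lemma cylinders_measurable J : cylinders J `<=` measurable.
Proof.
move=> _ [A mA ->]; elim: J => [|i J ih].
  by rewrite (_ : \bigcap_(j in _) _ = setT)//; apply/seteqP; split.
rewrite bigcap_mem_cons; apply: measurableI => //.
by rewrite -[X in measurable X]setTI; exact: mX.
Qed.

Lemma independent_cylinders J K : uniq (J ++ K) ->
  independent_systems <<s cylinders J >> <<s cylinders K >>.
Proof.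
move=> JK; apply: independent_g_sigma; [exact: cylindersT|exact: cylindersI|
  exact: cylinders_measurable|exact: cylindersT|exact: cylindersI|
  exact: cylinders_measurable|].
move=> _ _ [A mA ->] [B mB ->].
have /and3P[uJ dJK uK] : [&& uniq J, ~~ has (mem J) K & uniq K].
  by rewrite -cat_uniq.
have KJ j : j \in K -> (j \in J) = false.
  by move=> jK; apply: contraNF dJK => jJ; apply/hasP; exists j.
(* The two families are glued into one, so that the product formula for [J ++ K] applies;
   disjointness makes the gluing consistent. *)
pose C j := if j \in J then A j else B j.
have mC j : measurable (C j) by rewrite /C; case: ifP.
have := iX JK mC; rewrite big_cat/=.
rewrite (_ : \bigcap_(j in _) _ =
  \bigcap_(j in [set j | j \in J]) X j @^-1` A j `&`
  \bigcap_(j in [set j | j \in K]) X j @^-1` B j); last first.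
  apply/seteqP; split=> [w h|w [h1 h2] j /=].
    split=> j /= jI; have /= := h j; rewrite mem_cat jI ?orbT /C => /(_ isT).
      by rewrite jI.
    by rewrite KJ.
  by rewrite mem_cat /C; case: ifPn => [jJ _|_ /= jK]; [exact: h1|exact: h2].
move=> ->; rewrite iX// iX//; congr (_ * _)%E.
  by apply: eq_big_seq => j jJ; rewrite /C jJ.
by apply: eq_big_seq => j jK; rewrite /C KJ.
Qed.

Lemma measurable_fun_cylinders J j : j \in J ->
  measurable_fun setT (X j : g_sigma_algebraType (cylinders J) -> R).
Proof.
move=> jJ _ A mA; rewrite setTI; apply: sub_sigma_algebra.
exists (fun k => if k == j then A else setT).
  by move=> k; case: ifP.
apply/seteqP; split=> [w Aw k _ /=|w /(_ j jJ)/=]; last by rewrite eqxx.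
by case: eqP => // ->.
Qed.

Lemma sub_cylinders J K : {subset J <= K} ->
  <<s cylinders J >> `<=` <<s cylinders K >>.
Proof.
move=> JK; apply: smallest_sub; first exact: smallest_sigma_algebra.
move=> _ [A mA ->]; apply: sub_sigma_algebra.
exists (fun k => if k \in J then A k else setT).
  by move=> k; case: ifP.
apply/seteqP; split=> [w h k kK /=|w h k kJ]; first by case: ifP => // /h.
by have := h k (JK _ kJ); rewrite /= kJ.
Qed.

(** The two independent random elements are both the identity of [T], seen as maps into [T] with two
    coarser sigma-algebras. This expresses conditioning on the variables in [J] without introducing
    conditional expectations. *)
Lemma fubini_cylinders J K
    (f : g_sigma_algebraType (cylinders J) * g_sigma_algebraType (cylinders K)
         -> \bar R) : uniq (J ++ K) ->
  measurable_fun setT f -> (forall x, 0 <= f x)%E ->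
  (\int[P]_w f (w, w) = \int[P]_w \int[P]_w' f (w, w'))%E.
Proof.
move=> JK mf f0.
have mid L : measurable_fun setT (idfun : T -> g_sigma_algebraType (cylinders L)).
  move=> _ A mA; rewrite setTI.
  exact: (g_sigma_measurable (@cylinders_measurable L)).
apply: (fubini_independent (mid J) (mid K)) => // A B mA mB.
exact: (independent_cylinders JK).
Qed.

(** Induction on [s]: the events of the tail intersect in an event of the sigma-algebra of the
    concatenated tail blocks, a list disjoint from the head block. *)
Lemma independent_blocks (L : eqType) (s : seq L) (blk : L -> seq I)
    (B : L -> set T) :
  uniq (flatten (map blk s)) -> (forall l, <<s cylinders (blk l) >> (B l)) ->
  P (\bigcap_(l in [set l | l \in s]) B l) = (\prod_(l <- s) P (B l))%E.
Proof.
move=> + sB; elim: s => [_|l s ih /=].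
  rewrite big_nil (_ : \bigcap_(l in _) _ = setT) ?probability_setT//.
  by apply/seteqP; split.
move=> us; have /and3P[_ _ u2] : [&& uniq (blk l),
    ~~ has (mem (blk l)) (flatten (map blk s)) & uniq (flatten (map blk s))].
  by rewrite -cat_uniq.
rewrite big_cons -ih// -(independent_cylinders us)//.
  by rewrite bigcap_mem_cons.
elim: s {ih us u2} => [|k s ih] /=.
  rewrite (_ : \bigcap_(l in _) _ = setT); last by apply/seteqP; split.
  by apply: sub_sigma_algebra; exact: cylindersT.
rewrite bigcap_mem_cons.
apply: (@measurableI _ (g_sigma_algebraType (cylinders (blk k ++ flatten (map blk s))))).
  by apply: sub_cylinders (sB k) => i; rewrite mem_cat => ->.
by apply: sub_cylinders ih => i; rewrite mem_cat orbC => ->.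
Qed.

End cylinders.
End independence.

(** * Integration against a density, affine substitution and measurability tools *)

Section density.
Local Open Scope ereal_scope.
Context (R : realType) (d : measure_display) (T : measurableType d)
  (mu nu : {measure set T -> \bar R}) (f : T -> R).
Hypothesis mf : measurable_fun setT f.
Hypothesis f0 : forall x, (0 <= f x)%R.
Hypothesis nuE : forall A, measurable A -> nu A = \int[mu]_(x in A) (f x)%:E.
Import HBNNSimple.

Let integral_density_nnsfun (h : {nnsfun T >-> R}) :
  \int[nu]_x (h x)%:E = \int[mu]_x ((h x)%:E * (f x)%:E).
Proof.
under [LHS]eq_integral do rewrite fimfunE -fsumEFin//.
rewrite [LHS]ge0_integral_fsum//; last 2 first.
  - by move=> r; exact/measurable_EFinP/measurableT_comp.
  - by move=> n x _; rewrite EFinM nnfun_muleindic_ge0.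
under [RHS]eq_integral.
  move=> x xD; rewrite fimfunE -fsumEFin// ge0_mule_fsuml; last first.
    by move=> r; rewrite EFinM nnfun_muleindic_ge0.
  over.
rewrite [RHS]ge0_integral_fsum//; last 2 first.
  - move=> r; apply: emeasurable_funM; last exact/measurable_EFinP.
    exact/measurable_EFinP/measurableT_comp.
  - move=> n x _; apply: mule_ge0; last by rewrite lee_fin.
    by rewrite EFinM nnfun_muleindic_ge0.
apply: eq_fsbigr => r rh.
have r0 : (0 <= r)%R by move: rh; rewrite inE => -[x _ <-].
rewrite integralZl_indic_nnsfun//= integral_indic// setIT nuE//.
rewrite integral_mkcond -ge0_integralZl//.
- apply: eq_integral => x _; rewrite patchE indicE EFinM -muleA.
  by case: ifPn => _; rewrite ?mul1e// mul0e.
- by apply/measurable_restrict => //; exact/measurable_funTS/measurable_EFinP.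
- by move=> x _; rewrite erestrict_ge0// => y _; rewrite lee_fin.
Qed.

(** The formula holds for simple functions, and both sides pass to the limit along an increasing
    simple approximation by monotone convergence. *)
Lemma ge0_integral_density (h : T -> \bar R) :
  measurable_fun setT h -> (forall x, 0 <= h x) ->
  \int[nu]_x h x = \int[mu]_x (h x * (f x)%:E).
Proof.
move=> mh h0.
pose h_ := nnsfun_approx measurableT mh.
transitivity (limn (fun n => \int[nu]_x (h_ n x)%:E)).
  rewrite -monotone_convergence//=.
  - apply: eq_integral => x _; apply/esym/cvg_lim => //=.
    exact: cvg_nnsfun_approx.
  - by move=> n; exact/measurable_EFinP/measurable_funTS.
  - by move=> n x _; rewrite lee_fin.
  - by move=> x _ m n mn; rewrite lee_fin; exact/lefP/nd_nnsfun_approx.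
under eq_fun do rewrite integral_density_nnsfun.
rewrite -monotone_convergence//=.
- apply: eq_integral => x _; apply/cvg_lim => //=.
  apply: cvgeZr => //; exact: cvg_nnsfun_approx.
- move=> n; apply: emeasurable_funM; exact/measurable_EFinP/measurable_funTS.
- by move=> n x _; rewrite mule_ge0 ?lee_fin.
- move=> x _ m n mn; rewrite lee_wpmul2r ?lee_fin//.
  exact/lefP/nd_nnsfun_approx.
Qed.

End density.

Section affine.
Local Open Scope ereal_scope.
Context (R : realType).
Notation mu := (@lebesgue_measure R).

Lemma measurable_affine (k c : R) :
  measurable_fun setT (fun x : measurableTypeR R => (k * x + c)%R : measurableTypeR R).
Proof. by apply: measurable_funD => //; exact: mulrl_measurable. Qed.

(** The image of [|k| mu] under the affine map agrees with [mu] on the intervals []a, b]], which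
    characterize Lebesgue measure. For [k < 0] the preimage is closed on the left instead of on the
    right. *)
Lemma ge0_integral_affine (k c : R) (h : R -> \bar R) : (k != 0)%R ->
  measurable_fun setT h -> (forall x, 0 <= h x) ->
  \int[mu]_x h x = `|k|%:E * \int[mu]_x h (k * x + c)%R.
Proof.
move=> k0 mh h0.
pose phi (x : measurableTypeR R) : measurableTypeR R := (k * x + c)%R.
have mphi : measurable_fun setT phi by exact: measurable_affine.
have nk0 : (0 <= `|k|)%R by [].
rewrite (eq_measure_integral (pushforward (mscale (NngNum nk0) mu) phi)); last first.
  move=> A mA _; apply: lebesgue_measure_unique => //= _ [[a b]] _ <-.
  rewrite /pushforward /mscale/=.
  rewrite lebesgue_measure_itv/= lte_fin.
  have [kp|kn] := ltP 0%R k.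
    rewrite (_ : phi @^-1` _ = `]((a - c) / k)%R, ((b - c) / k)%R]%classic); last first.
      apply/seteqP; split=> x /=; rewrite !in_itv/= /phi ltr_pdivrMr// ler_pdivlMr//.
        by move=> /andP[? ?]; apply/andP; split; lra.
      by move=> /andP[? ?]; apply/andP; split; lra.
    rewrite lebesgue_measure_itv/= lte_fin ltr_pM2r ?invr_gt0// ltrD2r.
    case: ifPn => _; last by rewrite mule0.
    by rewrite gtr0_norm// -EFinD -EFinM; congr (_%:E); field.
  have {kn}kn : (k < 0)%R by rewrite lt_neqAle k0.
  rewrite (_ : phi @^-1` _ = `[((b - c) / k)%R, ((a - c) / k)%R[%classic); last first.
    apply/seteqP; split=> x /=; rewrite !in_itv/= /phi ltr_ndivlMr// ler_ndivrMr//.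
      by move=> /andP[? ?]; apply/andP; split; lra.
    by move=> /andP[? ?]; apply/andP; split; lra.
  rewrite lebesgue_measure_itv/= lte_fin ltr_nM2r ?invr_lt0// ltrD2r.
  case: ifPn => _; last by rewrite mule0.
  by rewrite ltr0_norm// -EFinD -EFinM; congr (_%:E); field.
rewrite ge0_integral_pushforward//.
rewrite preimage_setT ge0_integral_mscale//.
- by apply: measurableT_comp.
- by move=> x _; exact: h0.
Qed.
End affine.

Section measurable_floor_inv.
Context (R : realType).

Lemma measurable_floor : measurable_fun setT (fun x : R => (Num.floor x)%:~R : R).
Proof.
apply: nondecreasing_measurable => // x y xy /=.
rewrite ler_int; exact: le_floor.
Qed.

(** Inversion is discontinuous at 0, where [0^-1 = 0]; it is rewritten piecewise through [expR] and
    [ln], with the negative half obtained by reflection. *)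
Lemma measurable_inv : measurable_fun setT (fun x : R => x^-1).
Proof.
rewrite (_ : (fun _ => _) = fun x : R =>
  if 0 < x then expR (- ln x) else if x < 0 then - expR (- ln (- x)) else 0).
  apply: measurable_fun_ifT; first exact: measurable_fun_ltr.
    by apply: measurableT_comp => //; apply: measurable_funN; exact: measurable_ln.
  apply: measurable_fun_ifT => //; first exact: measurable_fun_ltr.
  apply: measurable_funN; apply: measurableT_comp => //; apply: measurable_funN.
  by apply: measurableT_comp => //; exact: measurable_funN.
apply/funext => x; case: ltrgtP => [x0|x0|<-]; last by rewrite invr0.
- by rewrite expRN lnK.
- by rewrite expRN lnK ?posrE ?oppr_gt0// invrN opprK.
Qed.

End measurable_floor_inv.

(** * Uniformity of the offset for a fixed scale [r] *)

Section rotation.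
Local Open Scope ereal_scope.
Context (R : realType).
Notation mu := (@lebesgue_measure R).
Notation offset r x b := (r * ((Num.floor (x / r + b)%R)%:~R + 1 - b) - x)%R.

(* the offset [r (t + 1 - beta) - x] is uniform on ]0, r] *)
Lemma integral_rotation (r x : R) (psi : R -> \bar R) : (0 < r)%R ->
  measurable_fun setT psi -> (forall y, 0 <= psi y) ->
  \int[mu]_(b in `[0%R, 1%R]) psi (offset r x b) =
  (r^-1)%:E * \int[mu]_(y in `]0%R, r]) psi y.
Proof.
move=> r0 mpsi psi0.
pose n : R := (Num.floor (x / r))%:~R; pose th := (x / r - n)%R.
have /andP[th0 th1] : (0 <= th < 1)%R.
  have := floor_itv (x / r); rewrite intrD -/n => /andP[? ?].
  by rewrite /th; apply/andP; split; lra.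
have rN0 : (- r != 0)%R by rewrite oppr_eq0 gt_eqF.
(* The floor is [n] for [b < 1 - th] and [n + 1] from there on. The offset is thus
   [r (1 - th) - r b] on the first piece and [r (2 - th) - r b] on the second, with images []0, r (1
   - th)]] and []r (1 - th), r]]; [psi1] and [psi2] cut [psi] accordingly. *)
pose psi1 y := if (0 < y <= r * (1 - th))%R then psi y else 0.
pose psi2 y := if (r * (1 - th) < y <= r)%R then psi y else 0.
have mpsi1 : measurable_fun setT psi1.
  apply: measurable_fun_ifT => //; apply: measurable_and.
    exact: measurable_fun_ltr.
  exact: measurable_fun_ler.
have mpsi2 : measurable_fun setT psi2.
  apply: measurable_fun_ifT => //; apply: measurable_and.
    exact: measurable_fun_ltr.
  exact: measurable_fun_ler.
have psi10 y : 0 <= psi1 y by rewrite /psi1; case: ifP.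
have psi20 y : 0 <= psi2 y by rewrite /psi2; case: ifP.
have mphi c : measurable_fun setT (fun b : R => - r * b + c)%R.
  by apply: measurable_funD => //; exact: mulrl_measurable.
have -> : \int[mu]_(y in `]0%R, r]) psi y = \int[mu]_y (psi1 y + psi2 y).
  rewrite integral_mkcond; apply: eq_integral => y _.
  rewrite patchE mem_setE in_itv/= /psi1 /psi2.
  have rth : (r * (1 - th) <= r)%R by nra.
  have [y0|y0] := ltP 0%R y => /=; last first.
    rewrite ifF ?adde0//; apply/negbTE; rewrite negb_and -leNgt.
    by apply/orP; left; apply: le_trans y0 _; rewrite mulr_ge0 ?subr_ge0 ?ltW.
  have [y1|y1] := leP y (r * (1 - th))%R => /=.
    by rewrite (le_trans y1 rth) adde0.
  by rewrite add0e.
rewrite ge0_integralD// (@ge0_integral_affine _ (- r) (r * (1 - th)))//.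
rewrite [X in _ * (_ + X)](@ge0_integral_affine _ (- r) (r * (2 - th)))//.
rewrite -ge0_muleDr ?integral_ge0// -ge0_integralD//; last 2 first.
- exact: (measurableT_comp mpsi1 (mphi _)).
- exact: (measurableT_comp mpsi2 (mphi _)).
rewrite muleA normrN gtr0_norm// -EFinM mulVf ?gt_eqF// mul1e.
(* The null endpoint [b = 1] is dropped, because the two integrands may differ there. *)
rewrite -integral_itv_bndo_bndc; last first.
  apply: measurable_funTS; apply: measurableT_comp => //.
  apply: measurable_funB => //; apply: measurable_funM => //.
  apply: measurable_funB => //; apply: measurable_funD => //.
  by apply: (measurableT_comp (@measurable_floor R)); exact: measurable_funD.
rewrite [LHS]integral_mkcond; apply: eq_integral => b _.
rewrite patchE mem_setE in_itv/= /psi1 /psi2.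
have xE : x = (r * (n + th))%R by rewrite /th addrCA subrr addr0 mulrC divfK ?gt_eqF.
have xrE : (x / r = n + th)%R by rewrite /th addrCA subrr addr0.
have [b1|b1] := ltP b (1 - th)%R.
  have [b0|b0] := leP 0%R b => /=; last first.
    rewrite !ifF ?adde0//; apply/negbTE; rewrite negb_and -ltNge -leNgt.
      by apply/orP; right; nra.
    by apply/orP; right; nra.
  have -> : Num.floor (x / r + b) = Num.floor (x / r).
    apply/eqP; rewrite floor_eq intrD -/n xrE; apply/andP; split; lra.
  rewrite -/n (_ : (b < 1)%R); last by lra.
  rewrite ifT; last by apply/andP; split; nra.
  rewrite ifF; last by apply/negbTE; rewrite negb_and -!ltNge -leNgt; apply/orP; right; nra.
  by rewrite adde0 xE; congr psi; ring.
rewrite (_ : (0 <= b)%R); last by lra.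
rewrite [in RHS]ifF ?add0e; last first.
  by apply/negbTE; rewrite negb_and -leNgt; apply/orP; left; nra.
have [b2|b2] := ltP b 1%R => /=; last first.
  by rewrite ifF//; apply/negbTE; rewrite negb_and -leNgt; apply/orP; left; nra.
have -> : Num.floor (x / r + b) = (Num.floor (x / r) + 1)%R.
  by apply/eqP; rewrite floor_eq !intrD -/n xrE; apply/andP; split; lra.
rewrite ifT; last by apply/andP; split; nra.
by rewrite intrD -/n xE; congr psi; ring.
Qed.
End rotation.

(** * Explicit integrals over half-lines *)

Section integrals.
Local Open Scope ereal_scope.
Context (R : realType).
Notation mu := (@lebesgue_measure R).

Lemma integral_FTCy (f F : R -> R) (a l : R) :
  (forall x, a <= x -> 0 <= f x)%R ->
  continuous f -> (F x @[x --> +oo%R] --> l)%R ->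
  (forall x, derivable F x 1 /\ 'D_1 F x = f x) ->
  \int[mu]_(x in `[a, +oo[) (f x)%:E = (l - F a)%:E.
Proof.
move=> f0 cf Fl dF.
rewrite (@ge0_continuous_FTC2y _ f F _ l)//.
- exact: continuous_subspaceT.
- by move=> x _; exact: (dF x).1.
- apply/cvg_at_right_filter/differentiable_continuous/derivable1_diffP.
  exact: (dF a).1.
- by move=> x _; rewrite derive1E (dF x).2.
Qed.

Lemma is_derive_split (F : R -> R) (x df : R) :
  is_derive x (1 : R)%R F df -> derivable F x 1 /\ 'D_1 F x = df.
Proof. by case. Qed.

Lemma derivable_continuous (F : R -> R) :
  (forall x, derivable F x 1) -> continuous F.
Proof. by move=> dF x; apply/differentiable_continuous/derivable1_diffP. Qed.

Lemma cvg_expRN_y (k : R) : (0 < k)%R ->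
  (expR (- (k * x)) @[x --> +oo] --> (0 : R))%R.
Proof.
move=> k0; rewrite (_ : (fun x => _) = (fun z => expR (- z)) \o *%R k)%R//.
by apply: (@cvg_comp _ _ _ _ _ _ (pinfty_nbhs R)); [exact: gt0_cvgMry|exact: cvgr_expR].
Qed.

(** Each primitive used below is [- F] with [F] dominated by a decaying exponential, so its limit at
    infinity is 0. *)
Lemma cvgN0_expRN_bound (k C : R) (F : R -> R) : (0 < k)%R ->
  (forall x, 0 <= x -> 0 <= F x <= C * expR (- (k * x)))%R ->
  (- F x @[x --> +oo] --> (0 : R))%R.
Proof.
move=> k0 FC; rewrite -oppr0; apply: cvgN.
apply: (@squeeze_cvgr _ _ _ _ (fun=> 0%R) (fun x => C * expR (- (k * x)))%R).
- by near=> x; apply: FC; near: x; exact: nbhs_pinfty_ge.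
- exact: cvg_cst.
- by rewrite -(mulr0 C); apply: cvgMr; exact: cvg_expRN_y.
Unshelve. all: by end_near. Qed.

Lemma integral_expRN (a : R) :
  \int[mu]_(x in `[a, +oo[) (expR (- x))%:E = (expR (- a))%:E.
Proof.
rewrite (@integral_FTCy _ (fun x => - expR (- x))%R a 0%R) ?sub0r ?opprK//.
- by apply: derivable_continuous => x; exact: ex_derive.
- apply: (@cvgN0_expRN_bound 1 1) => // x _.
  by rewrite !mul1r expR_ge0/=.
- by move=> x; apply: is_derive_split; apply: is_derive_eq; rewrite /GRing.scale/= ; ring.
Qed.

Lemma gamma21_pdf_ge0 (x : R) : (0 <= gamma21_pdf x)%R.
Proof. by rewrite /gamma21_pdf; case: ifP => // x0; rewrite mulr_ge0 ?expR_ge0// ltW. Qed.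

Lemma measurable_gamma21_pdf : measurable_fun setT (@gamma21_pdf R).
Proof.
apply: measurable_fun_ifT => //; first exact: measurable_fun_ltr.
by apply: measurable_funM => //; apply: measurableT_comp => //; exact: measurable_funN.
Qed.

Lemma integral_xexpRN (k a : R) : (0 < k)%R -> (0 <= a)%R ->
  \int[mu]_(x in `[a, +oo[) (x * expR (- (k * x)))%:E =
  ((k * a + 1) * expR (- (k * a)) / k ^+ 2)%:E.
Proof.
move=> k0 a0.
rewrite (@integral_FTCy _ (fun x => - ((k^-1 * x + k ^- 2) * expR (- (k * x))))%R a 0%R).
- by congr (_%:E); field; rewrite gt_eqF.
- by move=> x ax; rewrite mulr_ge0 ?expR_ge0// (le_trans a0).
- by apply: derivable_continuous => x; exact: ex_derive.
(* Half of the decay rate is spent on the linear factor: by [1 + y <= e^y] at [y = k x / 2], the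
   factor [x / k + k^-2] is at most [2 k^-2 e^(k x / 2)]. *)
- apply: (@cvgN0_expRN_bound (k / 2) (2 * k ^- 2)); first by rewrite divr_gt0.
  move=> x x0; apply/andP; split.
    rewrite mulr_ge0 ?expR_ge0// addr_ge0 ?mulr_ge0 ?invr_ge0 ?exprn_ge0//; exact: ltW.
  have -> : (- (k * x) = - (k / 2 * x) + - (k / 2 * x))%R by field.
  rewrite expRD mulrA ler_wpM2r ?expR_ge0// expRN ler_pdivrMr ?expR_gt0//.
  have := expR_ge1Dx (k / 2 * x)%R.
  have -> : (k^-1 * x + k ^- 2 = 2 * k ^- 2 * (2^-1 + k / 2 * x))%R.
    by field; rewrite gt_eqF.
  move=> h; rewrite ler_wpM2l ?mulr_ge0 ?invr_ge0 ?exprn_ge0 ?(ltW k0)//.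
  by apply: le_trans h; lra.
- move=> x; apply: is_derive_split; apply: is_derive_eq.
  rewrite /GRing.scale/= !mulr1 ?mulr0 ?addr0 ?add0r.
  by field; rewrite gt_eqF.
Qed.

(** With [(1 + s) e^(- s)] the tail of Gamma(2,1), this is the probability that [c e^(- y)] exceeds
    [a] for an independent [y ~ Exp(1)]. The integrand is the exact derivative of
    [- e^(- y) e^(- a e^y)], and the result is the tail of Exp(1). *)
Lemma integral_expR_expR (a : R) : (0 < a)%R ->
  \int[mu]_(y in `[0%R, +oo[)
    ((1 + a * expR y) * expR (- (a * expR y)) * expR (- y))%:E = (expR (- a))%:E.
Proof.
move=> a0.
rewrite (@integral_FTCy _ (fun y => - (expR (- y) * expR (- (a * expR y))))%R 0%R 0%R).
- by rewrite oppr0 expR0 mulr1 mul1r sub0r opprK.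
- by move=> x _; rewrite !mulr_ge0 ?expR_ge0// addr_ge0// mulr_ge0 ?expR_ge0// ltW//.
- by apply: derivable_continuous => x; exact: ex_derive.
- apply: (@cvgN0_expRN_bound 1 1) => // x x0.
  rewrite mulr_ge0 ?expR_ge0//= !mul1r ler_piMr ?expR_ge0//.
  by rewrite -expR0 ler_expR oppr_le0 mulr_ge0 ?expR_ge0 ?ltW.
- move=> x; apply: is_derive_split; apply: is_derive_eq.
  by rewrite /GRing.scale/=; ring.
Qed.

(* [e^-y / (1 + l e^-y)^2 = e^y / (e^y + l)^2], with primitive [- (e^y + l)^-1] *)
Lemma integral_logistic (l : R) : (0 <= l)%R ->
  \int[mu]_(y in `[0%R, +oo[)
    (expR (- y) / (1 + l * expR (- y)) ^+ 2)%:E = ((1 + l)^-1)%:E.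
Proof.
move=> l0.
have pos (x : R) : (0 < expR x + l)%R by rewrite ltr_wpDr// expR_gt0.
transitivity (\int[mu]_(y in `[0%R, +oo[) (expR y / (expR y + l) ^+ 2)%:E).
  apply: eq_integral => y _; congr (_%:E); rewrite expRN; field.
  have := pos y; have := expR_gt0 y => y0 yl.
  by rewrite !gt_eqF//.
have dF (x : R) : is_derive x (1 : R)%R (fun y => - (expR y + l)^-1)%R
    (expR x / (expR x + l) ^+ 2)%R.
  have /lt0r_neq0 px := pos x.
  apply: is_derive_eq; rewrite /GRing.scale/=. by field.
rewrite (@integral_FTCy _ (fun y => - (expR y + l)^-1)%R 0%R 0%R).
- by rewrite expR0 sub0r opprK.
- by move=> x _; rewrite divr_ge0 ?expR_ge0// sqr_ge0.
- apply: derivable_continuous => x; have /lt0r_neq0 px := pos x.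
  have px2 : ((expR x + l) ^+ 2 != 0)%R by rewrite sqrf_eq0.
  exact: ex_derive.
- apply: (@cvgN0_expRN_bound 1 1) => // x x0.
  rewrite invr_ge0 ltW//= !mul1r expRN lef_pV2 ?posrE ?expR_gt0//.
  by rewrite lerDl.
- by move=> x; apply: is_derive_split.
Qed.
End integrals.

(** * Joint law of the scale and the offset *)

Section offset.
Local Open Scope ereal_scope.
Context (R : realType).
Notation mu := (@lebesgue_measure R).
Notation offset r x b := (r * ((Num.floor (x / r + b)%R)%:~R + 1 - b) - x)%R.

(* Under [r ~ Gamma(2,1)] and [b] uniform, the offset is [Exp(1)] and
   independent of [r - offset], which is [Exp(1)] too. *)
Lemma integral_gamma21_offset (x dlt : R) (kappa : R -> \bar R) : (0 <= dlt)%R ->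
  measurable_fun setT kappa -> (forall y, 0 <= kappa y) ->
  \int[mu]_r (\int[mu]_(b in `[0%R, 1%R])
      (if (offset r x b <= r - dlt)%R then kappa (offset r x b) else 0)
     * (gamma21_pdf r)%:E) =
  (expR (- dlt))%:E * \int[mu]_(y in `[0%R, +oo[) (kappa y * (expR (- y))%:E).
Proof.
move=> dlt0 mk k0.
(* The uniform density [1 / r] of the offset cancels the factor [r] of [r e^(- r)], so the pair
   (scale, offset) has density [e^(- r)] on [0 < y <= r]; [F] adds the constraint [y + dlt <= r]. *)
pose F (ry : R * R) : \bar R :=
  if (0 < ry.2)%R && (ry.2 + dlt <= ry.1)%R
  then kappa ry.2 * (expR (- ry.1))%:E else 0.
have mF : measurable_fun setT F.
  apply: measurable_fun_ifT => //.
    apply: measurable_and; first exact: measurable_fun_ltr.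
    by apply: measurable_fun_ler => //; exact: measurable_funD.
  apply: emeasurable_funM; first exact: measurableT_comp.
  apply/measurable_EFinP; apply: measurableT_comp => //.
  exact: measurable_funN.
have F0 z : 0 <= F z by rewrite /F; case: ifP => // _; rewrite mule_ge0 ?lee_fin ?expR_ge0.
have mexpN : measurable_fun setT (fun y : R => (expR (- y))%:E).
  apply/measurable_EFinP; apply: measurableT_comp => //; exact: measurable_funN.
transitivity (\int[mu]_r \int[mu]_y F (r, y)).
  apply: eq_integral => r _.
  have [r0|r0] := ltP 0%R r; last first.
    rewrite /gamma21_pdf ltNge r0/= mule0 integral0_eq// => y _.
    rewrite /F /= ifF//; apply/negbTE; rewrite negb_and -leNgt -ltNge.
    by case: (leP y 0%R) => //= y0; lra.
  rewrite (@integral_rotation _ r x (fun y : R => if (y <= r - dlt)%R then kappa y else 0))//.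
  - have mpsi : measurable_fun setT (fun y : R => if (y <= r - dlt)%R then kappa y else 0).
      by apply: measurable_fun_ifT => //; exact: measurable_fun_ler.
    rewrite muleAC -EFinM /gamma21_pdf r0 mulrA mulVf ?gt_eqF// mul1r -ge0_integralZl//.
    + rewrite integral_mkcond; apply: eq_integral => y _.
      rewrite patchE mem_setE in_itv/= /F/= lerBrDr.
      have [y0|y0]//= := ltP 0%R y.
      have [yr|yr] := leP (y + dlt)%R r.
        by rewrite ifT; [rewrite muleC|lra].
      by rewrite mule0; case: ifP.
    + exact: measurable_funTS.
    + by move=> y _; case: ifP.
  - by apply: measurable_fun_ifT => //; exact: measurable_fun_ler.
  - by move=> y; case: ifP.
(* After exchanging the integrals, the inner one over [r >= y + dlt] is [e^(- y) e^(- dlt)], and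
   [dlt] factors out. *)
rewrite fubini_tonelli//.
transitivity (\int[mu]_(y in `[0%R, +oo[)
    ((expR (- dlt))%:E * (kappa y * (expR (- y))%:E))); last first.
  rewrite ge0_integralZl//.
  - by apply: measurable_funTS; exact: emeasurable_funM.
  - by move=> y _; rewrite mule_ge0 ?lee_fin ?expR_ge0.
rewrite -integral_itv_obnd_cbnd; last first.
  apply: measurable_funTS; apply: emeasurable_funM => //.
  exact: emeasurable_funM.
rewrite [RHS]integral_mkcond; apply: eq_integral => y _.
rewrite patchE mem_setE in_itv/= andbT /F/=.
have [y0|y0]/= := ltP 0%R y; last by rewrite integral0_eq.
transitivity (kappa y * \int[mu]_(r in `[(y + dlt)%R, +oo[) (expR (- r))%:E).
  rewrite -ge0_integralZl//.
  - rewrite [RHS]integral_mkcond; apply: eq_integral => r _.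
    by rewrite patchE mem_setE in_itv/= andbT.
  - exact: measurable_funTS.
rewrite integral_expRN opprD expRD EFinM muleA muleC.
by congr (_ * _).
Qed.
End offset.

(** * The quantized value, its offset and its key *)

Section quantization.
Context (R : realType).
Implicit Types x y r c b : R.

(* [t] and [a] of the sampling procedure, with [x = p * log s] *)
Definition quant x r b : int := Num.floor (x / r + b).
Definition quant_offset x r b : R := r * ((quant x r b)%:~R + 1 - b) - x.
Definition quant_key x r c b : R := ln c - r * ((quant x r b)%:~R + 1 - b).

Lemma quant_keyE x r c b : quant_key x r c b = ln c - x - quant_offset x r b.
Proof. by rewrite /quant_key /quant_offset; ring. Qed.

(** Let [t] be the quantized value of [y]. Since [x <= y], the upper bound [x / r + b < t + 1] is
    inherited, so equality amounts to [t <= x / r + b]; multiplied by [r], this is a bound on the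
    offset of [y]. *)
Lemma quant_eqE x y r b : 0 < r -> x <= y ->
  (quant x r b == quant y r b) = (quant_offset y r b <= r - (y - x)).
Proof.
move=> r0 xy; rewrite /quant_offset.
have -> : quant x r b = Num.floor (x / r + b) by [].
rewrite floor_eq -/(quant y r b); set t := quant y r b.
have /andP[_] := floor_itv (y / r + b); rewrite -/(quant y r b) -/t => yt.
have xyr : x / r <= y / r by rewrite ler_pM2r ?invr_gt0.
have -> : (x / r + b < (t + 1)%:~R) = true.
  by apply: le_lt_trans yt; rewrite lerD2r.
rewrite andbT -(ler_pM2l r0) mulrDr mulrCA divff ?gt_eqF// mulr1.
by apply/idP/idP => h; lra.
Qed.

Lemma measurable_quant (d : measure_display) (T : measurableType d) x
    (r b : T -> R) : measurable_fun setT r -> measurable_fun setT b ->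
  measurable_fun setT (fun w => (quant x (r w) (b w))%:~R : R).
Proof.
move=> mr mb; apply: (measurableT_comp (@measurable_floor R)).
apply: measurable_funD => //; apply: measurable_funM => //.
exact: (measurableT_comp (@measurable_inv R)).
Qed.

Lemma measurable_quant_offset (d : measure_display) (T : measurableType d) x
    (r b : T -> R) : measurable_fun setT r -> measurable_fun setT b ->
  measurable_fun setT (fun w => quant_offset x (r w) (b w)).
Proof.
move=> mr mb; apply: measurable_funB => //; apply: measurable_funM => //.
apply: measurable_funB => //; apply: measurable_funD => //.
exact: measurable_quant.
Qed.

Lemma measurable_quant_key (d : measure_display) (T : measurableType d) x
    (r c b : T -> R) : measurable_fun setT r -> measurable_fun setT c ->
  measurable_fun setT b ->
  measurable_fun setT (fun w => quant_key x (r w) (c w) (b w)).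
Proof.
move=> mr mc mb; apply: measurable_funB.
  exact: (measurableT_comp (@measurable_ln R)).
apply: measurable_funM => //; apply: measurable_funB => //.
by apply: measurable_funD => //; exact: measurable_quant.
Qed.

Lemma measurable_quant_eq (d : measure_display) (T : measurableType d) x y
    (r b : T -> R) : measurable_fun setT r -> measurable_fun setT b ->
  measurable_fun setT (fun w => quant x (r w) (b w) == quant y (r w) (b w)).
Proof.
move=> mr mb; under eq_fun do rewrite -(eqr_int R).
by apply: measurable_fun_eqr; exact: measurable_quant.
Qed.

End quantization.

(** * From expectations to Lebesgue integrals *)

Section laws.
Local Open Scope ereal_scope.
Context (R : realType) (d : measure_display) (T : measurableType d)
  (P : probability T R).
Notation mu := (@lebesgue_measure R).

Definition gamma21_law (X : T -> R) := forall A, measurable A ->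
  P (X @^-1` A) = \int[mu]_(x in A) (gamma21_pdf x)%:E.

Definition uniform01_law (X : T -> R) := forall A, measurable A ->
  P (X @^-1` A) = uniform_prob (@ltr01 R) A.

Lemma expectation_gamma21 (X : T -> R) (h : R -> \bar R) :
  measurable_fun setT X -> gamma21_law X ->
  measurable_fun setT h -> (forall x, 0 <= h x) ->
  \int[P]_w h (X w) = \int[mu]_x (h x * (gamma21_pdf x)%:E).
Proof.
move=> mX lX mh h0.
have mX' : measurable_fun setT (X : T -> measurableTypeR R) by [].
pose X' : {mfun T >-> measurableTypeR R} :=
  HB.pack (X : T -> measurableTypeR R) (isMeasurableFun.Build _ _ _ _ _ mX').
transitivity (\int[distribution P X']_x h x).
  by rewrite ge0_integral_distribution.
apply: (@ge0_integral_density _ _ _ mu (distribution P X') (@gamma21_pdf R)) => //.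
- exact: measurable_gamma21_pdf.
- exact: gamma21_pdf_ge0.
Qed.

Lemma expectation_uniform01 (X : T -> R) (h : R -> \bar R) :
  measurable_fun setT X -> uniform01_law X ->
  measurable_fun setT h -> (forall x, 0 <= h x) ->
  \int[P]_w h (X w) = \int[mu]_(x in `[0%R, 1%R]) h x.
Proof.
move=> mX lX mh h0.
have mX' : measurable_fun setT (X : T -> measurableTypeR R) by [].
pose X' : {mfun T >-> measurableTypeR R} :=
  HB.pack (X : T -> measurableTypeR R) (isMeasurableFun.Build _ _ _ _ _ mX').
transitivity (\int[distribution P X']_x h x).
  by rewrite ge0_integral_distribution.
rewrite (eq_measure_integral (uniform_prob (@ltr01 R))); last first.
  by move=> A mA _; exact: lX.
by rewrite integral_uniform// subr0 invr1 mul1e.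
Qed.

Context (I : eqType) (X : I -> T -> R).
Hypothesis mX : forall i, measurable_fun setT (X i).
Hypothesis iX : mutually_independent P X.

(** [H] is left arbitrary because two instances are needed, a tail indicator and a Laplace
    transform. The test [0 < X i w] excludes a null set on which [quant_eqE] does not apply.
    Independence is used twice, to split [c] from the pair [(r, beta)] and then [r] from [beta]. *)
Lemma expectation_quant (i j k : I) (x dlt : R) (H : R * R -> \bar R) :
  uniq [:: i; k; j] ->
  gamma21_law (X i) -> gamma21_law (X j) -> uniform01_law (X k) ->
  (0 <= dlt)%R -> measurable_fun setT H -> (forall z, 0 <= H z) ->
  \int[P]_w (if (0 < X i w)%R &&
                (quant (x - dlt)%R (X i w) (X k w) == quant x (X i w) (X k w))
             then H (X j w, quant_offset x (X i w) (X k w)) else 0) =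
  (expR (- dlt))%:E * \int[mu]_(y in `[0%R, +oo[)
    ((\int[mu]_c (H (c, y) * (gamma21_pdf c)%:E)) * (expR (- y))%:E).
Proof.
move=> u lr lc lb dlt0 mH H0.
pose test (r b : R) := (0 < r)%R && (quant (x - dlt)%R r b == quant x r b).
pose kappa y := \int[mu]_c (H (c, y) * (gamma21_pdf c)%:E).
have kappa0 y : 0 <= kappa y.
  by apply: integral_ge0 => c _; rewrite mule_ge0 ?lee_fin ?gamma21_pdf_ge0.
have mkappa : measurable_fun setT kappa.
  pose G (z : R * R) := H (z.2, z.1) * (gamma21_pdf z.2)%:E.
  have G0 z : 0 <= G z by rewrite mule_ge0 ?lee_fin ?gamma21_pdf_ge0.
  apply: (@measurable_fun_fubini_tonelli_F _ _ _ _ _ mu G) => //.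
  apply: emeasurable_funM.
    by apply: measurableT_comp => //; exact: measurable_fun_pair.
  by apply/measurable_EFinP; apply: (measurableT_comp (@measurable_gamma21_pdf R)).
have mtest : measurable_fun setT (fun z : R * R => test z.1 z.2).
  apply: measurable_and; first exact: measurable_fun_ltr.
  exact: measurable_quant_eq.
have mH1 : measurable_fun setT (fun z : (R * R) * R =>
    if test z.1.1 z.1.2 then H (z.2, quant_offset x z.1.1 z.1.2) else 0).
  apply: measurable_fun_ifT => //.
    by apply: (measurableT_comp mtest).
  apply: (measurableT_comp mH); apply: measurable_fun_pair => //.
  by apply: measurable_quant_offset; exact: measurableT_comp.
have H10 (z : (R * R) * R) :
    0 <= if test z.1.1 z.1.2 then H (z.2, quant_offset x z.1.1 z.1.2) else 0.
  by case: ifP.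
have mXik : measurable_fun setT (fun w => (X i w, X k w)).
  exact: measurable_fun_pair.
rewrite (@fubini_independent _ _ _ P _ _ _ _ (fun w => (X i w, X k w)) (X j) _
   mXik (mX j) _ mH1 H10); last first.
  move=> A B mA mB; apply: (independent_cylinders mX iX (J := [:: i; k]) (K := [:: j]) u).
  - have := measurable_fun_pair (@measurable_fun_cylinders _ _ _ _ X [:: i; k] i _)
      (@measurable_fun_cylinders _ _ _ _ X [:: i; k] k _).
    rewrite !inE !eqxx orbT => /(_ isT isT measurableT _ mA).
    by rewrite setTI.
  - have := @measurable_fun_cylinders _ _ _ _ X [:: j] j.
    by rewrite inE => /(_ (eqxx _) measurableT _ mB); rewrite setTI.
transitivity (\int[P]_w (if test (X i w) (X k w) then
    kappa (quant_offset x (X i w) (X k w)) else 0)).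
  apply: eq_integral => w _ /=; case: ifP => _; last by rewrite integral0.
  rewrite (@expectation_gamma21 (X j) (fun c => H (c, _)))//.
  by apply: measurableT_comp => //; exact: measurable_pair2.
have mK : measurable_fun setT (fun z : R * R =>
    if test z.1 z.2 then kappa (quant_offset x z.1 z.2) else 0).
  apply: measurable_fun_ifT => //.
  by apply: (measurableT_comp mkappa); exact: measurable_quant_offset.
have K0 (z : R * R) : 0 <= if test z.1 z.2 then kappa (quant_offset x z.1 z.2) else 0.
  by case: ifP.
rewrite (@fubini_independent _ _ _ P _ _ _ _ (X i) (X k) _ (mX i) (mX k) _ mK K0);
    last first.
  have uik : uniq ([:: i] ++ [:: k]).
    by move: u; rewrite /= !inE negb_or => /and3P[/andP[-> _]].
  move=> A B mA mB; apply: (independent_cylinders mX iX uik).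
  - have := @measurable_fun_cylinders _ _ _ _ X [:: i] i.
    by rewrite inE => /(_ (eqxx _) measurableT _ mA); rewrite setTI.
  - have := @measurable_fun_cylinders _ _ _ _ X [:: k] k.
    by rewrite inE => /(_ (eqxx _) measurableT _ mB); rewrite setTI.
rewrite -(@integral_gamma21_offset _ x)//.
rewrite (@expectation_gamma21 (X i) (fun r => \int[P]_w'
   (if test r (X k w') then kappa (quant_offset x r (X k w')) else 0)))//.
- apply: eq_integral => r _.
  have [r0|r0] := ltP 0%R r; last by rewrite /gamma21_pdf ltNge r0 !mule0.
  congr (_ * _).
  rewrite (@expectation_uniform01 (X k) (fun b =>
    if test r b then kappa (quant_offset x r b) else 0))//.
  + apply: eq_integral => b _; rewrite /test r0/= quant_eqE//; last by lra.
    by rewrite (_ : x - (x - dlt) = dlt)%R//; ring.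
  + exact: (measurableT_comp mK (g := fun b : R => (r, b)) (measurable_pair1 _)).
  + by move=> b; case: ifP.
- apply: (@measurable_fun_fubini_tonelli_F _ _ _ _ _ P (fun z : R * T =>
    if test z.1 (X k z.2) then kappa (quant_offset x z.1 (X k z.2)) else 0)).
    2: by move=> z; case: ifP.
  apply: (measurableT_comp mK (g := fun z : R * T => (z.1, X k z.2))).
  by apply: measurable_fun_pair => //; exact: measurableT_comp.
- by move=> r; apply: integral_ge0 => w _; case: ifP.
Qed.
End laws.

Lemma measurable_bool_set (d : measure_display) (T : measurableType d)
  (f : T -> bool) : measurable_fun setT f -> measurable [set w | f w].
Proof. by move=> mf; rewrite -[X in measurable X]setTI; exact: (mf measurableT [set true]). Qed.

(** * Law of a single key *)

Section keys.
Local Open Scope ereal_scope.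
Context (R : realType) (d : measure_display) (T : measurableType d)
  (P : probability T R) (I : eqType) (X : I -> T -> R).
Hypothesis mX : forall i, measurable_fun setT (X i).
Hypothesis iX : mutually_independent P X.
Notation mu := (@lebesgue_measure R).
Variables (i j k : I).
Hypothesis uijk : uniq [:: i; k; j].
Hypotheses (lr : gamma21_law P (X i)) (lc : gamma21_law P (X j))
  (lb : uniform01_law P (X k)).

Let gamma21E (a : R) (c : R) : (0 <= a)%R -> (a < c)%R ->
  gamma21_pdf c = (c * expR (- c))%R.
Proof. by move=> a0 ac; rewrite /gamma21_pdf (le_lt_trans a0 ac). Qed.

Lemma gamma21_tail (s : R) : (0 <= s)%R ->
  \int[mu]_c ((if (s < c)%R then 1 else 0) * (gamma21_pdf c)%:E) =
  ((1 + s) * expR (- s))%:E.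
Proof.
move=> s0.
have -> : ((1 + s) * expR (- s) = (1 * s + 1) * expR (- (1 * s)) / 1 ^+ 2)%R.
  by rewrite !mul1r expr1n divr1 addrC.
rewrite -integral_xexpRN// -integral_itv_obnd_cbnd; last first.
  apply/measurable_EFinP; apply: measurable_funTS; apply: measurable_funM => //.
  by apply: measurableT_comp => //; apply: measurable_funN; exact: mulrl_measurable.
rewrite [RHS]integral_mkcond; apply: eq_integral => c _.
rewrite patchE mem_setE in_itv/= andbT; case: ifPn => sc; last by rewrite mul0e.
by rewrite mul1e mul1r (gamma21E s0 sc).
Qed.

Lemma gamma21_laplace (m : R) : (0 <= m)%R ->
  \int[mu]_c ((if (0 < c)%R then (expR (- (m * c)))%:E else 0) * (gamma21_pdf c)%:E) =
  ((1 + m) ^- 2)%:E.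
Proof.
move=> m0; have m1 : (0 < 1 + m)%R by rewrite ltr_wpDr.
have -> : ((1 + m) ^- 2 = ((1 + m) * 0 + 1) * expR (- ((1 + m) * 0)) / (1 + m) ^+ 2)%R.
  by rewrite mulr0 oppr0 expR0 add0r mulr1 mul1r.
rewrite -integral_xexpRN// -integral_itv_obnd_cbnd; last first.
  apply/measurable_EFinP; apply: measurable_funTS; apply: measurable_funM => //.
  by apply: measurableT_comp => //; apply: measurable_funN; exact: mulrl_measurable.
rewrite [RHS]integral_mkcond; apply: eq_integral => c _.
rewrite patchE mem_setE in_itv/= andbT; case: ifPn => sc; last by rewrite mul0e.
rewrite (gamma21E (lexx _) sc) -EFinM mulrCA -expRD; congr (_ * expR _)%:E.
by ring.
Qed.

(* [c e^(- y)] with [y ~ Exp(1)] is [Exp(1)], so the exponential of the key is [Exp(e^x)] *)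
Lemma prob_key_gt (x al : R) :
  P [set w | [&& 0 < X i w, 0 < X j w & al < quant_key x (X i w) (X j w) (X k w)]%R] =
  (expR (- expR (x + al)))%:E.
Proof.
set A := [set _ | _].
have mA : measurable A.
  apply: measurable_bool_set; apply: measurable_and; first exact: measurable_fun_ltr.
  apply: measurable_and; first exact: measurable_fun_ltr.
  by apply: measurable_fun_ltr => //; exact: measurable_quant_key.
pose H (z : R * R) : \bar R :=
  if (0 < z.1)%R && (al < ln z.1 - x - z.2)%R then 1 else 0.
have mH : measurable_fun setT H.
  apply: measurable_fun_ifT => //; apply: measurable_and; first exact: measurable_fun_ltr.
  apply: measurable_fun_ltr => //; apply: measurable_funB => //.
  by apply: measurable_funB => //; exact: (measurableT_comp (@measurable_ln R)).
have H0 z : 0 <= H z by rewrite /H; case: ifP.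
(* With [dlt = 0] the quantization test is vacuous. *)
have := expectation_quant mX iX x uijk lr lc lb (lexx 0%R) mH H0.
rewrite oppr0 expR0 mul1e addr0.
rewrite [X in X = _ -> _](_ : _ = P A); last first.
  rewrite -[X in P X]setIT -integral_indic//; apply: eq_integral => w _.
  rewrite eqxx andbT /H/= -quant_keyE indicE.
  case: (boolP (0 < X i w)%R) => /= wi; last first.
    by rewrite memNset// /A/= (negbTE wi).
  case: ifPn => wj; first by rewrite mem_set// /A/= wi.
  by rewrite memNset// /A/= wi/=; exact/negP.
move=> ->.
rewrite -integral_expR_expR ?expR_gt0//; apply: eq_integral => y _.
rewrite [RHS]EFinM; congr (_ * _).
rewrite -expRD -gamma21_tail ?expR_ge0//; apply: eq_integral => c _.
congr (_ * _); rewrite /H/=.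
have [c0|c0] := ltP 0%R c => /=; last first.
  by rewrite ltNge (le_trans c0 (expR_ge0 _)).
by rewrite -{2}(lnK c0) ltr_expR; congr (if _ then _ else _); apply/idP/idP; lra.
Qed.

(** For [lam] the total rate of the rivals, [e^(- lam e^a)] is the chance that all their keys exceed
    [a]. Given the offset [y], the Laplace transform of [c] yields [(1 + lam e^(- x) e^(- y))^-2],
    and averaging over [y ~ Exp(1)] is the logistic integral. *)
Lemma expectation_key (x dlt lam : R) : (0 <= dlt)%R -> (0 <= lam)%R ->
  \int[P]_w (if [&& 0 < X i w, 0 < X j w &
      quant (x - dlt) (X i w) (X k w) == quant x (X i w) (X k w)]%R
    then (expR (- (lam * expR (quant_key x (X i w) (X j w) (X k w)))))%:E else 0) =
  (expR (- dlt) / (1 + lam * expR (- x)))%:E.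
Proof.
move=> dlt0 lam0.
pose H (z : R * R) : \bar R :=
  if (0 < z.1)%R then (expR (- (lam * expR (ln z.1 - x - z.2))))%:E else 0.
have mH : measurable_fun setT H.
  apply: measurable_fun_ifT => //; first exact: measurable_fun_ltr.
  apply/measurable_EFinP; apply: measurableT_comp => //; apply: measurable_funN.
  apply: measurable_funM => //; apply: measurableT_comp => //.
  apply: measurable_funB => //; apply: measurable_funB => //.
  exact: (measurableT_comp (@measurable_ln R)).
have H0 z : 0 <= H z by rewrite /H; case: ifP => // _; rewrite lee_fin expR_ge0.
transitivity (\int[P]_w (if (0 < X i w)%R &&
                (quant (x - dlt)%R (X i w) (X k w) == quant x (X i w) (X k w))
             then H (X j w, quant_offset x (X i w) (X k w)) else 0)).
  apply: eq_integral => w _; rewrite /H/= -quant_keyE.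
  by case: (0 < X i w)%R => //=; case: (0 < X j w)%R => //=; case: ifP.
rewrite (expectation_quant mX iX x uijk lr lc lb dlt0 mH H0) [RHS]EFinM; congr (_ * _).
rewrite -integral_logistic ?mulr_ge0 ?expR_ge0//; apply: eq_integral => y _.
rewrite [RHS]EFinM muleC; congr (_ * _).
rewrite -gamma21_laplace ?mulr_ge0 ?expR_ge0//; apply: eq_integral => c _.
congr (_ * _); rewrite /H/=; case: ifPn => // c0; congr (expR (- _))%:E.
by rewrite !expRD lnK//; ring.
Qed.

End keys.

Lemma measurable_fun_all (d : measure_display) (T : measurableType d) (K : eqType)
    (f : K -> T -> bool) (s : seq K) :
  {in s, forall k, measurable_fun setT (f k)} ->
  measurable_fun setT (fun w => all (f^~ w) s).
Proof.
elim: s => [|k s ih] mf; first exact: measurable_cst.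
apply: measurable_and; first by apply: mf; rewrite inE eqxx.
by apply: ih => l ls; apply: mf; rewrite inE ls orbT.
Qed.

(** * The race of independent exponential keys *)

Section race.
Context (R : realType) (d : measure_display) (T : measurableType d)
  (P : probability T R) (D : nat) (X : gcws_index D -> T -> R).
Hypothesis mX : forall i, measurable_fun setT (X i).
Hypothesis iX : mutually_independent P X.

Definition r_idx (j : 'I_(2 * D)) : gcws_index D := inl (j, @Ordinal 3 0 isT).
Definition c_idx (j : 'I_(2 * D)) : gcws_index D := inl (j, @Ordinal 3 1 isT).
Definition b_idx (j : 'I_(2 * D)) : gcws_index D := inl (j, @Ordinal 3 2 isT).
Definition block (j : 'I_(2 * D)) := [:: r_idx j; b_idx j; c_idx j].

Lemma uniq_blocks s : uniq s -> uniq (flatten (map block s)).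
Proof.
move=> us.
rewrite (_ : flatten _ = [seq (inl (j, m) : gcws_index D)
  | j <- s, m <- [:: @Ordinal 3 0 isT; @Ordinal 3 2 isT; @Ordinal 3 1 isT]]); last by [].
apply: allpairs_uniq => //.
by move=> [j m] [j' m'] _ _ /= [-> ->].
Qed.

Hypotheses (lr : forall j, gamma21_law P (X (r_idx j)))
  (lc : forall j, gamma21_law P (X (c_idx j)))
  (lb : forall j, uniform01_law P (X (b_idx j))).
Variables (x : 'I_(2 * D) -> R) (pos : pred 'I_(2 * D)).

Definition key j w := quant_key (x j) (X (r_idx j) w) (X (c_idx j) w) (X (b_idx j) w).
Definition proper j w := (0 < X (r_idx j) w) && (0 < X (c_idx j) w).
(** Positivity of the draws and strict inequalities are part of a win, so that the deterministic
    comparison of outputs holds at every point of the event and wins of distinct indices in [pos]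
    are disjoint. *)
Definition wins i w := proper i w &&
  [forall k, (k != i) && pos k ==> proper k w && (key i w < key k w)].
Definition same_quant y j w :=
  quant y (X (r_idx j) w) (X (b_idx j) w) == quant (x j) (X (r_idx j) w) (X (b_idx j) w).

Section sub.
Variable (J : seq (gcws_index D)).
Notation TJ := (g_sigma_algebraType (cylinders X J)).

(** Measurability is needed for the sigma-algebra generated by [J], not just the ambient one, since
    independence is expressed through the former. *)
Lemma measurable_key_block j : {subset block j <= J} ->
  measurable_fun setT (key j : TJ -> R).
Proof.
move=> jJ; apply: measurable_quant_key; apply: measurable_fun_cylinders;
  by apply: jJ; rewrite !inE eqxx ?orbT.
Qed.

Lemma measurable_proper_block j : {subset block j <= J} ->
  measurable_fun setT (proper j : TJ -> bool).
Proof.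
move=> jJ; apply: measurable_and; apply: measurable_fun_ltr => //;
  apply: measurable_fun_cylinders; by apply: jJ; rewrite !inE eqxx ?orbT.
Qed.

Lemma measurable_same_quant_block y j : {subset block j <= J} ->
  measurable_fun setT (same_quant y j : TJ -> bool).
Proof.
move=> jJ; apply: measurable_quant_eq;
  apply: measurable_fun_cylinders; by apply: jJ; rewrite !inE eqxx ?orbT.
Qed.

End sub.

Lemma uniq_block j : uniq (block j).
Proof. exact: (@uniq_blocks [:: j]). Qed.

(** Rates add in a minimum of independent exponentials: the product of the tails
    [e^(- e^(x_k) e^al)] over disjoint blocks. *)
Lemma prob_all_keys_gt (s : seq 'I_(2 * D)) (al : R) : uniq s ->
  P [set w | all (fun k => proper k w && (al < key k w)) s] =
  (expR (- ((\sum_(k <- s) expR (x k)) * expR al)))%:E.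
Proof.
move=> us.
have B k : P [set w | proper k w && (al < key k w)] = (expR (- expR (x k + al)))%:E.
  rewrite -(prob_key_gt mX iX (uniq_block k) (lr k) (lc k) (lb k)).
  by congr (P _); apply/seteqP; split=> w; rewrite /= /proper andbA.
transitivity (P (\bigcap_(k in [set k | k \in s]) [set w | proper k w && (al < key k w)])).
  congr (P _); apply/seteqP; split=> w /=.
    by move=> /allP h k /= ks; exact: h.
  by move=> h; apply/allP => k ks; exact: h.
rewrite (independent_blocks mX iX (blk := block)) ?uniq_blocks//; last first.
  move=> k; apply: (@measurable_bool_set _ (g_sigma_algebraType (cylinders X (block k)))).
  apply: measurable_and; first exact: measurable_proper_block.
  by apply: measurable_fun_ltr => //; exact: measurable_key_block.
under eq_bigr do rewrite B.
rewrite mulr_suml -sumrN expR_sum -prodEFin.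
by apply: eq_bigr => k _; rewrite expRD.
Qed.

Definition rivals i := [seq k <- enum 'I_(2 * D) | (k != i) && pos k].

Lemma wins_rivals i w : wins i w =
  proper i w && all (fun k => proper k w && (key i w < key k w)) (rivals i).
Proof.
congr (_ && _); apply/forallP/allP => h k.
  by rewrite mem_filter mem_enum andbT => kp; have := h k; rewrite kp.
by apply/implyP => kp; apply: h; rewrite mem_filter mem_enum andbT.
Qed.

Lemma measurable_proper j : measurable_fun setT (proper j).
Proof. by apply: measurable_and; exact: measurable_fun_ltr. Qed.

Lemma measurable_key j : measurable_fun setT (key j).
Proof. exact: measurable_quant_key. Qed.

Lemma measurable_wins i : measurable_fun setT (wins i).
Proof.
have -> : wins i = fun w =>
    proper i w && all (fun k => proper k w && (key i w < key k w)) (rivals i).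
  by apply/funext => w; exact: wins_rivals.
apply: measurable_and; first exact: measurable_proper.
apply: (@measurable_fun_all _ _ _ (fun k w => proper k w && (key i w < key k w))).
move=> k _; apply: measurable_and; first exact: measurable_proper.
by apply: measurable_fun_ltr; exact: measurable_key.
Qed.

(** Given block [i], the rivals all lose with probability [e^(- lam e^(key i))], where [lam] is the
    sum of their rates. Averaging over block [i] gives [e^(- dlt) / (1 + lam e^(- x_i))], which is
    the claim after multiplying through by [e^(x_i)]. *)
Lemma race i dlt : pos i -> 0 <= dlt ->
  P [set w | wins i w && same_quant (x i - dlt) i w] =
  (expR (- dlt) * expR (x i) / \sum_(k | pos k) expR (x k))%:E.
Proof.
move=> pi dlt0.
set s := rivals i.
have us : uniq (i :: s) by rewrite /= mem_filter eqxx/= filter_uniq// enum_uniq.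
have uJK : uniq (block i ++ flatten (map block s)) by exact: (@uniq_blocks (i :: s)).
set J := block i in uJK; set K := flatten (map block s) in uJK.
pose test w := proper i w && same_quant (x i - dlt) i w.
(* The first argument carries the draws of index [i], the second those of its rivals, which prepares
   the decoupling. *)
pose f (z : g_sigma_algebraType (cylinders X J) * g_sigma_algebraType (cylinders X K))
   : \bar R := if test z.1 && all (fun k => proper k z.2 && (key i z.1 < key k z.2)) s
  then 1%E else 0%E.
have sK k : k \in s -> {subset block k <= K}.
  by move=> ks l lk; apply/flattenP; exists (block k) => //; exact: map_f.
have mtest : measurable_fun setT (test : g_sigma_algebraType (cylinders X J) -> bool).
  apply: measurable_and; first exact: measurable_proper_block.
  exact: measurable_same_quant_block.
have mf : measurable_fun setT f.
  apply: measurable_fun_ifT => //; apply: measurable_and.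
    exact: (measurableT_comp mtest measurable_fst).
  apply: (@measurable_fun_all _ (g_sigma_algebraType (cylinders X J) *
      g_sigma_algebraType (cylinders X K))%type _
    (fun k z => proper k z.2 && (key i z.1 < key k z.2))).
  move=> k ks; apply: measurable_and.
    exact: (measurableT_comp (measurable_proper_block (sK _ ks)) measurable_snd).
  apply: measurable_fun_ltr.
    exact: (measurableT_comp (@measurable_key_block J i (fun _ => id)) measurable_fst).
  exact: (measurableT_comp (measurable_key_block (sK _ ks)) measurable_snd).
have f0 z : (0 <= f z)%E by rewrite /f; case: ifP.
have mA : measurable [set w | wins i w && same_quant (x i - dlt) i w].
  apply: measurable_bool_set; apply: measurable_and; first exact: measurable_wins.
  exact: measurable_quant_eq.
rewrite -[X in P X]setIT -integral_indic//.
transitivity (\int[P]_w f (w, w))%E.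
  apply: eq_integral => w _; rewrite indicE /f/= andbAC -wins_rivals.
  by case: ifPn => [h|/negP h]; [rewrite mem_set|rewrite memNset].
rewrite (fubini_cylinders mX iX uJK mf f0).
pose lam := \sum_(k <- s) expR (x k).
have lam0 : 0 <= lam by apply: sumr_ge0 => k _; exact: expR_ge0.
transitivity (\int[P]_w (if [&& 0 < X (r_idx i) w, 0 < X (c_idx i) w & same_quant (x i - dlt) i w]%R
    then (expR (- (lam * expR (key i w))))%:E else 0%E))%E.
  apply: eq_integral => w _; rewrite /f/= andbA -/(proper i w) -/(test w).
  case: (test w) => /=; last by rewrite integral0.
  rewrite -prob_all_keys_gt; last by case/andP: us.
  set B := [set _ | _].
  have mB : measurable B.
    apply: measurable_bool_set.
    apply: (@measurable_fun_all _ _ _ (fun k w' => proper k w' && (key i w < key k w'))).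
    move=> k ks; apply: measurable_and; first exact: measurable_proper.
    by apply: measurable_fun_ltr => //; exact: measurable_key.
  rewrite -[X in P X]setIT -integral_indic//; apply: eq_integral => w' _.
  by rewrite indicE; case: ifPn => [h|/negP h]; [rewrite mem_set|rewrite memNset].
rewrite (expectation_key mX iX (uniq_block i))//; congr (_%:E).
rewrite (bigD1 i)//= (_ : \sum_(k | pos k && (k != i)) expR (x k) = lam); last first.
  rewrite /lam big_filter big_enum_cond/=; apply: eq_bigl => k.
  by rewrite andbC.
rewrite [expR (- x i)]expRN; field.
by rewrite !gt_eqF// ?expR_gt0// ltr_wpDr// expR_gt0.
Qed.

End race.

(** * Pointwise comparison of the two outputs *)

Section deterministic.
Context (R : realType).
Implicit Types x y r c b : R.

Lemma quant_le x y r b : 0 < r -> x <= y -> quant x r b <= quant y r b.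
Proof. by move=> r0 xy; apply: le_floor; rewrite lerD2r ler_pM2r ?invr_gt0. Qed.

Lemma quant_key_le x y r c b : 0 < r -> x <= y ->
  quant_key y r c b <= quant_key x r c b.
Proof.
move=> r0 xy; rewrite /quant_key lerD2l lerN2 ler_pM2l// lerB// lerD2r ler_int.
exact: quant_le.
Qed.

Context (D : nat) (p : R).
Hypothesis p0 : 0 < p.
Variables (r c b : 'I_(2 * D) -> R).
Notation logw s j := (p * ln (s j)).
Notation qt s j := (quant (logw s j) (r j) (b j)).
Notation qk s j := (quant_key (logw s j) (r j) (c j) (b j)).

Lemma sign_split_ge0 (u : 'I_D -> R) j : 0 <= sign_split u j.
Proof.
rewrite /sign_split; case: ifP => _; case: ifPn => //; first exact: ltW.
by rewrite -leNgt oppr_ge0.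
Qed.

Lemma sign_split_pos (u : 'I_D -> R) : (exists i, u i != 0) ->
  exists j, 0 < sign_split u j.
Proof.
move=> [i ui].
have [ui0|ui0] := ltP 0 (u i).
  have h : (2 * i < 2 * D)%N by rewrite ltn_pmul2l.
  exists (Ordinal h); rewrite /sign_split/= (_ : half_ord _ = i).
    by rewrite ui0 mul2n odd_double.
  by apply/val_inj; rewrite /= mulKn.
have ui1 : (0 < u i) = false by apply/negbTE; rewrite -leNgt.
have h : (2 * i + 1 < 2 * D)%N.
  by rewrite addn1 !mul2n -doubleS leq_double.
exists (Ordinal h); rewrite /sign_split/= (_ : half_ord _ = i).
  rewrite oddD mul2n odd_double/= ui1 oppr_gt0.
  by rewrite lt_neqAle ui.
by apply/val_inj; rewrite /= mulnC divnMDl// divn_small// addn0.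
Qed.

Lemma gcws_argmin (u : 'I_D -> R) : (exists j, 0 < sign_split u j) ->
  exists i, [/\ gcws p u r c b = Some (i, qt (sign_split u) i),
    0 < sign_split u i &
    forall k, 0 < sign_split u k -> qk (sign_split u) i <= qk (sign_split u) k].
Proof.
move=> [j uj]; rewrite /gcws; case: pickP => [i /andP[ui /forallP h]|h].
  by exists i; split=> // k uk; have := h k; rewrite uk.
exfalso; pose i := [arg min_(i < j | 0 < sign_split u i) qk (sign_split u) i]%O.
have := h i; rewrite /i; case: arg_minP => // k uk hk.
rewrite uk/=; move/negbT/forallP; apply=> l; apply/implyP => ul; exact: hk.
Qed.

Lemma gcws_strict_argmin (u : 'I_D -> R) i : 0 < sign_split u i ->
  (forall k, k != i -> 0 < sign_split u k ->
    qk (sign_split u) i < qk (sign_split u) k) ->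
  gcws p u r c b = Some (i, qt (sign_split u) i).
Proof.
move=> ui hi; have [|k [-> uk hk]] := @gcws_argmin u; first by exists i.
have [->//|ki] := eqVneq k i.
by have := lt_le_trans (hi _ ki uk) (hk _ ui); rewrite ltxx.
Qed.

Variables (u v : 'I_D -> R).
Notation su := (sign_split u).
Notation sv := (sign_split v).
Let M j := Order.max (su j) (sv j).
Let m j := Order.min (su j) (sv j).

(** Lowering the vector from [M] to [s] can only raise keys, while the key of [i] stays fixed
    because it depends on the vector only through the quantized value. The strict winner for [M]
    therefore remains the strict winner. *)
Lemma gcws_max_unique (s : 'I_D -> R) i : 0 < r i -> 
  (forall k, k != i -> 0 < M k -> (0 < r k) && (qk M i < qk M k)) ->
  (forall k, sign_split s k <= M k) -> 0 < sign_split s i ->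
  qt (sign_split s) i = qt M i -> gcws p s r c b = Some (i, qt M i).
Proof.
move=> ri hM sM si sq; rewrite -sq; apply: gcws_strict_argmin => // k ki sk.
have Mk : 0 < M k by apply: lt_le_trans (sM k).
have /andP[rk] := hM _ ki Mk.
have -> : qk (sign_split s) i = qk M i by rewrite /quant_key sq.
move=> h; apply: lt_le_trans h _; apply: quant_key_le => //.
by rewrite ler_pM2l// ler_ln.
Qed.

(* A collision forces the common index to minimise the key of [max u v]. *)
Lemma gcws_collision i : 0 < M i -> 0 < r i ->
  (exists j, 0 < su j) -> (exists j, 0 < sv j) ->
  (forall k, k != i -> 0 < M k -> (0 < r k) && (qk M i < qk M k)) ->
  (gcws p u r c b == gcws p v r c b) = (0 < m i) && (qt m i == qt M i).
Proof.
move=> Mi ri exu exv hM; apply/eqP/andP => [uv|[mi /eqP mM]].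
  have [k [uE uk hu]] := gcws_argmin exu; have [l [vE vl hv]] := gcws_argmin exv.
  move: uv; rewrite uE vE => -[kl tE]; subst l.
  (* By [tE] both vectors quantize alike at [k], and [M k] and [m k] are each one of the two
     entries. *)
  have qM : qt M k = qt su k by rewrite /M; case: leP.
  have qm : qt m k = qt su k by rewrite /m; case: leP.
  have ki : k = i.
    apply/eqP/negP => /negP ki.
    have Mk : 0 < M k by rewrite /M lt_max uk.
    have /andP[_] := hM _ ki Mk; apply/negP; rewrite -leNgt.
    (* Whichever vector attains [M i] has at [i] the same key as [M], and it prefers [k] to [i].
       Since its key at [k] also equals that of [M], this contradicts the strict win of [i]. *)
    have [uvi|uvi] := leP (su i) (sv i).
      have -> : qk M i = qk sv i by rewrite /M max_r.
      rewrite (_ : qk M k = qk sv k); last by rewrite /quant_key qM tE.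
      by apply: hv; move: Mi; rewrite /M max_r.
    have -> : qk M i = qk su i by rewrite /M max_l// ltW.
    rewrite (_ : qk M k = qk su k); last by rewrite /quant_key qM.
    by apply: hu; move: Mi; rewrite /M max_l// ltW.
  by subst k; rewrite qM qm eqxx /m lt_min uk vl.
have [ui vi] : 0 < su i /\ 0 < sv i by apply/andP; rewrite -lt_min.
(* Quantization is monotone, so agreement at [m i] and [M i] extends to every value between them, in
   particular to the entries of [u] and [v]. *)
have sandwich s : m i <= s <= M i -> quant (p * ln s) (r i) (b i) = qt M i.
  move=> /andP[ms sM]; have s0 : 0 < s by apply: lt_le_trans ms.
  apply/eqP; rewrite eq_le -{2}mM; apply/andP; split;
    apply: quant_le => //; by rewrite ler_pM2l// ler_ln.
rewrite !(@gcws_max_unique _ i)//.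
- by move=> k; rewrite /M le_max lexx orbT.
- by apply: sandwich; rewrite /m /M ge_min le_max !lexx !orbT.
- by move=> k; rewrite /M le_max lexx.
- by apply: sandwich; rewrite /m /M ge_min le_max !lexx.
Qed.

End deterministic.

(** * Splitting events along discrete random variables, and measurability of the output *)

Section countable_partition.
Local Open Scope ereal_scope.
Context (R : realType) (d : measure_display) (T : measurableType d)
  (K : countType) (Z : T -> K).
Hypothesis mZ : forall z, measurable [set w | Z w = z].

Lemma measurable_partition (A : set T) :
  (forall z, measurable (A `&` [set w | Z w = z])) -> measurable A.
Proof.
move=> mA.
pose F n := if unpickle n is Some z then A `&` [set w | Z w = z] else set0.
have -> : A = \bigcup_n F n.
  apply/seteqP; split=> [w Aw|w [n _]].
    by exists (pickle (Z w)) => //; rewrite /F pickleK.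
  by rewrite /F; case: unpickle => // z [].
by apply: bigcupT_measurable => n; rewrite /F; case: unpickle.
Qed.

(** The pieces must be disjoint here, hence [pickle_inv] in place of [unpickle], which may decode
    several integers to the same value. *)
Lemma measure_partition (m : {measure set T -> \bar R}) (A : set T) : measurable A ->
  m A = \sum_(0 <= n <oo) m (if @pickle_inv K n is Some z then
    A `&` [set w | Z w = z] else set0).
Proof.
move=> mA.
pose F n := if @pickle_inv K n is Some z then A `&` [set w | Z w = z] else set0.
have AE : A = \bigcup_n F n.
  apply/seteqP; split=> [w Aw|w [n _]].
    by exists (pickle (Z w)) => //; rewrite /F pickleK_inv.
  by rewrite /F; case: pickle_inv => // z [].
rewrite {1}AE measure_bigcup//=.
- by apply: eq_eseriesl => n; rewrite in_setT.
- by move=> n _; rewrite /F; case: pickle_inv => // z; exact: measurableI.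
- move=> n k _ _ [w []]; rewrite /F.
  case En: (@pickle_inv K n) => [z|]//; case Ek: (@pickle_inv K k) => [z'|]// [_ zw] [_ zw'].
  have := @pickle_invK K n; have := @pickle_invK K k; rewrite En Ek/= => <- <-.
  by rewrite -zw -zw'.
Qed.

Lemma measure_partition_scale (m : {measure set T -> \bar R}) (A B : set T) (q : R) :
  (0 <= q)%R -> measurable A -> measurable B ->
  (forall z, m (A `&` [set w | Z w = z]) = q%:E * m (B `&` [set w | Z w = z])) ->
  m A = q%:E * m B.
Proof.
move=> q0 mA mB h; rewrite (measure_partition m mA) (measure_partition m mB).
rewrite -nneseriesZl//; apply: eq_eseriesr => n _.
by case: pickle_inv => [z|]; [exact: h|rewrite !measure0 mule0].
Qed.

End countable_partition.

Lemma measure_fin_partition (R : realType) (d : measure_display) (T : measurableType d)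
    (K : finType) (Z : T -> K) (m : {measure set T -> \bar R}) (A : set T) :
  (forall z, measurable [set w | Z w = z]) -> measurable A ->
  m A = (\sum_z m (A `&` [set w | Z w = z]))%E.
Proof.
move=> mZ mA.
have {1}-> : A = \bigcup_(z in [set: K]) (A `&` [set w | Z w = z]).
  by apply/seteqP; split=> [w Aw|w [z _ []]//]; exists (Z w).
rewrite measure_fin_bigcup//=.
- have h z : [set: K] z -> z \notin index_enum K -> m (A `&` [set w | Z w = z]) = 0%E.
    by rewrite mem_index_enum.
  rewrite (fsbigE (index_enum K) _ (index_enum_uniq K) _ h)//.
  by apply: eq_bigl => z; rewrite in_setT.
- by move=> z z' _ _ [w [[_ <-] [_ <-]]].
- by move=> z _; exact: measurableI.
Qed.

(** The truth table of [Q] at [w] is one of finitely many [F], and the event is the union over those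
    [F] on which [pick] returns [o]. The union is written as a negated [all] to reuse
    [measurable_fun_all]. *)
Lemma measurable_pick_eq (d : measure_display) (T : measurableType d) (K : finType)
    (Q : K -> T -> bool) (o : option K) :
  (forall k, measurable_fun setT (Q k)) ->
  measurable [set w | [pick k | Q k w] = o].
Proof.
move=> mQ.
rewrite (_ : [set w | _] = [set w | ~~ all (fun F : {ffun K -> bool} =>
    ~~ (([pick k | F k] == o) && all (fun k => Q k w == F k) (enum K)))
   (enum {ffun K -> bool})]).
  apply: measurable_bool_set; apply: (measurable_neg (f := fun w => all _ _)).
  apply: (@measurable_fun_all _ _ _ (fun (F : {ffun K -> bool}) w =>
    ~~ (([pick k | F k] == o) && all (fun k => Q k w == F k) (enum K)))).
  move=> F _; apply: measurable_neg; apply: measurable_and => //.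
  apply: (@measurable_fun_all _ _ _ (fun k w => Q k w == F k)) => k _.
  rewrite (_ : (fun w => _) = if F k then Q k else fun w => ~~ Q k w); last first.
    by apply/funext => w; case: (F k); case: (Q k w).
  by case: (F k) => //; exact: measurable_neg.
apply/seteqP; split=> w /=.
  move=> h; apply/allPn; exists [ffun k => Q k w]; first by rewrite mem_enum.
  rewrite negbK; apply/andP; split.
    by rewrite -h; apply/eqP; apply: eq_pick => k; rewrite ffunE.
  by apply/allP => k _; rewrite ffunE.
move=> /allPn[F _]; rewrite negbK => /andP[/eqP <- /allP h].
by apply: eq_pick => k; apply/eqP; apply: h; rewrite mem_enum.
Qed.

Section gcws_measurable.
Context (R : realType) (d : measure_display) (T : measurableType d) (D : nat) (p : R)
  (u : 'I_D -> R) (r c b : 'I_(2 * D) -> T -> R).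
Hypotheses (mr : forall j, measurable_fun setT (r j))
  (mc : forall j, measurable_fun setT (c j)) (mb : forall j, measurable_fun setT (b j)).

(** On each set where the picked index is constant, the output depends only on one quantized value.
    Keeping [T] generic allows a later use with the sigma-algebra generated by the sampling
    variables alone. *)
Lemma measurable_gcws o :
  measurable [set w | gcws p u (r^~ w) (c^~ w) (b^~ w) = o].
Proof.
pose Q i w := (0 < sign_split u i) && [forall k, (0 < sign_split u k) ==>
  (gcws_a p u (r^~ w) (c^~ w) (b^~ w) i <= gcws_a p u (r^~ w) (c^~ w) (b^~ w) k)].
have mQ i : measurable_fun setT (Q i).
  apply: measurable_and => //.
  rewrite (_ : (fun w => _) = (fun w => all (fun k => (0 < sign_split u k) ==>
    (gcws_a p u (r^~ w) (c^~ w) (b^~ w) i <= gcws_a p u (r^~ w) (c^~ w) (b^~ w) k))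
    (enum 'I_(2 * D)))); last first.
    apply/funext => w; apply/forallP/allP => h k; last by apply: h; rewrite mem_enum.
    by move=> _; exact: h.
  apply: (@measurable_fun_all _ _ _ (fun k w => (0 < sign_split u k) ==>
    (gcws_a p u (r^~ w) (c^~ w) (b^~ w) i <= gcws_a p u (r^~ w) (c^~ w) (b^~ w) k))).
  move=> k _; case: (0 < sign_split u k) => //=.
  by apply: measurable_fun_ler; exact: measurable_quant_key.
apply: (@measurable_partition _ _ (option 'I_(2 * D)) (fun w => [pick i | Q i w])).
move=> z; pose t i w := gcws_t p u (r^~ w) (b^~ w) i.
rewrite (_ : _ `&` _ = [set w | omap (fun i => (i, t i w)) z = o] `&`
    [set w | [pick i | Q i w] = z]); last first.
  by apply/seteqP; split=> w [/= + wz]; rewrite /gcws/= -?wz//= wz.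
apply: measurableI; last exact: measurable_pick_eq.
case: z o => [i|] [[j n]|] /=; last first.
- by rewrite (_ : [set w | _] = setT)//; apply/seteqP; split.
- by rewrite (_ : [set w | _] = set0)//; apply/seteqP; split.
- by rewrite (_ : [set w | _] = set0)//; apply/seteqP; split.
have [->|ij] := eqVneq i j; last first.
  by rewrite (_ : [set w | _] = set0)//; apply/seteqP; split=> w //= [/eqP]; rewrite (negbTE ij).
rewrite (_ : [set w | _] = [set w | (t j w)%:~R == n%:~R :> R]).
  apply: measurable_bool_set; apply: measurable_fun_eqr => //.
  exact: measurable_quant.
by apply/seteqP; split=> w /=; rewrite eqr_int; [move=> [->]|move/eqP->].
Qed.

End gcws_measurable.

(** * Collision probability of the unhashed outputs *)

Section collision.
Context (R : realType) (d : measure_display) (T : measurableType d)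
  (P : probability T R) (D : nat) (X : gcws_index D -> T -> R).
Hypothesis mX : forall i, measurable_fun setT (X i).
Hypothesis iX : mutually_independent P X.
Hypotheses (lr : forall j, gamma21_law P (X (r_idx j)))
  (lc : forall j, gamma21_law P (X (c_idx j)))
  (lb : forall j, uniform01_law P (X (b_idx j))).
Variables (p : R) (u v : 'I_D -> R).
Hypotheses (p0 : 0 < p) (u0 : exists i, u i != 0) (v0 : exists i, v i != 0).

Definition sample (s : 'I_D -> R) w := gcws p s (fun j => X (r_idx j) w)
  (fun j => X (c_idx j) w) (fun j => X (b_idx j) w).

Let M j := Order.max (sign_split u j) (sign_split v j).
Let m j := Order.min (sign_split u j) (sign_split v j).
Let x j := p * ln (M j).
Let pos : pred 'I_(2 * D) := fun j => 0 < M j.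
Let S := \sum_j (M j) `^ p.

Let M0 j : 0 <= M j. Proof. by rewrite /M le_max sign_split_ge0. Qed.
Let m0 j : 0 <= m j. Proof. by rewrite /m le_min !sign_split_ge0. Qed.
Let mM j : m j <= M j. Proof. by rewrite /m /M ge_min !le_max lexx. Qed.

Let powRE (s : R) : 0 < s -> s `^ p = expR (p * ln s).
Proof. by move=> s0; rewrite /powR gt_eqF. Qed.

Let posN j : ~~ pos j -> M j = 0.
Proof. by rewrite /pos -leNgt => h; apply/eqP; rewrite eq_le h M0. Qed.

Let SE : S = \sum_(k | pos k) expR (x k).
Proof.
rewrite /S [RHS]big_mkcond/=; apply: eq_bigr => k _; case: ifPn => [/powRE//|/posN ->].
by rewrite powR0// gt_eqF.
Qed.

Let S0 : 0 < S.
Proof.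
rewrite SE; have [j uj] := sign_split_pos u0.
have pj : pos j by rewrite /pos /M lt_max uj.
by rewrite (bigD1 j)//= ltr_wpDr ?expR_gt0// sumr_ge0// => k _; exact: expR_ge0.
Qed.

Lemma measurable_sample s o : measurable [set w | sample s w = o].
Proof. exact: measurable_gcws. Qed.

Lemma measurable_collision : measurable [set w | sample u w = sample v w].
Proof.
apply: (@measurable_partition _ _ _ (sample u) _ ) => o.
rewrite (_ : _ `&` _ = [set w | sample u w = o] `&` [set w | sample v w = o]).
  by apply: measurableI; exact: measurable_sample.
by apply/seteqP; split=> w /= [h1 h2]; rewrite ?h1 ?h2// -h1.
Qed.

Lemma prob_wins i : pos i -> P [set w | wins X x pos i w] = ((M i) `^ p / S)%:E.
Proof.
move=> pi; have := race mX iX lr lc lb x pi (lexx 0).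
rewrite oppr0 expR0 mul1r -SE powRE// -/(x i) => <-.
by congr (P _); apply/seteqP; split=> w /=; rewrite /same_quant addr0 eqxx andbT.
Qed.

Lemma prob_collision_wins i : pos i ->
  P ([set w | sample u w = sample v w] `&` [set w | wins X x pos i w]) =
  ((m i) `^ p / S)%:E.
Proof.
move=> pi.
have E w : wins X x pos i w -> (sample u w == sample v w) = (0 < m i) &&
    (quant (p * ln (m i)) (X (r_idx i) w) (X (b_idx i) w) ==
     quant (p * ln (M i)) (X (r_idx i) w) (X (b_idx i) w)).
  move=> /andP[/andP[ri ci] /forallP wi]; apply: gcws_collision => //.
  - exact: sign_split_pos.
  - exact: sign_split_pos.
  - move=> k ki Mk; have /implyP := wi k; rewrite ki/= => /(_ Mk).
    by move=> /andP[/andP[-> _] ->].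
have [mi|mi] := ltP 0 (m i); last first.
  rewrite (_ : _ `&` _ = set0).
    have -> : m i = 0 by apply/eqP; rewrite eq_le mi m0.
    by rewrite measure0 powR0 ?mul0r// gt_eqF.
  apply/seteqP; split=> w //= [/eqP h wi]; move: h.
  by rewrite E// ltNge mi.
(* With this shift [x i - dlt = p ln (m i)], so the quantization test in [race] is the collision
   condition and [e^(- dlt) e^(x_i) = m_i^p]. *)
pose dlt := p * ln (M i) - p * ln (m i).
have dlt0 : 0 <= dlt by rewrite subr_ge0 ler_pM2l// ler_ln// posrE.
have := race mX iX lr lc lb x pi dlt0.
rewrite -expRD -SE (_ : - dlt + x i = p * ln (m i)); last by rewrite /dlt /x; ring.
rewrite powRE// => <-; congr (P _).
have xd : x i - dlt = p * ln (m i) by rewrite /dlt /x; ring.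
apply/seteqP; split=> w /=; rewrite /same_quant xd.
  by move=> [/eqP h wi]; move: h; rewrite E// wi => /andP[].
by move=> /andP[wi h]; split=> //; apply/eqP; rewrite E// mi.
Qed.

Lemma prob_collision : P [set w | sample u w = sample v w] = (pGMM u v p)%:E.
Proof.
pose W w := [pick i | pos i && wins X x pos i w].
have mW o : measurable [set w | W w = o].
  apply: measurable_pick_eq => i; apply: measurable_and => //.
  exact: measurable_wins.
have WE i : [set w | W w = Some i] = if pos i then [set w | wins X x pos i w] else set0.
  apply/seteqP; split=> w /=.
    by rewrite /W; case: pickP => // j /andP[pj wj] [<-]; rewrite pj.
  case: ifPn => // pi wi; rewrite /W; case: pickP => [j /andP[pj wj]|/(_ i)]; last first.
    by rewrite pi wi.
  congr Some; apply/eqP/negP => /negP ji.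
  move: wi wj => /andP[_ /forallP/(_ j)] + /andP[_ /forallP/(_ i)].
  rewrite ji eq_sym ji pi pj/= => /andP[_ h1] /andP[_ h2].
  by have := lt_trans h1 h2; rewrite ltxx.
have split A : measurable A -> P A = (P (A `&` [set w | W w = None]) +
    \sum_i P (A `&` [set w | W w = Some i]))%E.
  move=> mA; rewrite (measure_fin_partition P mW mA) (bigD1 None)//=; congr (_ + _)%E.
  rewrite (reindex_omap Some id)/=; last by case.
  by apply: eq_bigl => i; rewrite eqxx.
(* The winning probabilities [M_i^p / S] already sum to 1, so nonpositive draws and ties are
   negligible together. *)
have PN : P [set w | W w = None] = 0%E.
  have := split _ measurableT; rewrite probability_setT setTI.
  rewrite (eq_bigr (fun i => ((M i) `^ p / S)%:E)); last first.
    move=> i _; rewrite setTI WE; case: ifPn => [|/posN Mi]; first exact: prob_wins.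
    by rewrite measure0 Mi powR0 ?mul0r// gt_eqF.
  rewrite sumEFin -mulr_suml divff ?gt_eqF// => h.
  have fN : P [set w | W w = None] \is a fin_num by exact: fin_num_measure.
  by move: h; rewrite -[P _]fineK// -EFinD => -[] h; congr (_%:E); lra.
rewrite (split _ measurable_collision) (_ : P (_ `&` [set w | W w = None]) = 0%E); last first.
  apply/eqP; rewrite eq_le measure_ge0 andbT -PN; apply: le_measure; rewrite ?inE//.
  by apply: measurableI => //; exact: measurable_collision.
rewrite add0e (eq_bigr (fun i => ((m i) `^ p / S)%:E)).
  by rewrite sumEFin -mulr_suml.
move=> i _; rewrite WE; case: ifPn => [|/posN Mi]; first exact: prob_collision_wins.
rewrite setI0 measure0 (_ : m i = 0) ?powR0 ?mul0r ?gt_eqF//.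
by apply/eqP; rewrite eq_le m0 andbT -Mi.
Qed.

End collision.

(** * Random hashing of the outputs *)

Section hashing.
Context (R : realType) (d : measure_display) (T : measurableType d)
  (P : probability T R) (D b : nat) (r c beta : 'I_(2 * D) -> T -> R)
  (g : T -> 'I_(2 * D) * int -> 'I_(2 ^ b)).
Let X := gcws_family r c beta g.
Hypothesis mX : forall k, measurable_fun setT (X k).
Hypothesis iX : mutually_independent P X.
Let q : R := (2 ^ b)%:R^-1.
Hypothesis hg : forall a (k : 'I_(2 ^ b)), P [set w | g w a = k] = q%:E.

Let gE a a' w : (X (inr a) w == X (inr a') w) = (g w a == g w a').
Proof. by rewrite /X/= eqr_nat. Qed.

Lemma hash_levelE a (k : 'I_(2 ^ b)) :
  [set w | g w a = k] = X (inr a) @^-1` [set (k : nat)%:R].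
Proof.
apply/seteqP; split=> w /=; first by move=> ->.
by move/eqP; rewrite eqr_nat => /eqP/val_inj.
Qed.

Lemma hash_level_cylinder a (k : 'I_(2 ^ b)) J : inr a \in J ->
  <<s cylinders X J >> [set w | g w a = k].
Proof.
move=> aJ; rewrite hash_levelE -[X in _ X]setTI.
exact: (measurable_fun_cylinders aJ measurableT).
Qed.

Lemma measurable_hash_level a (k : 'I_(2 ^ b)) : measurable [set w | g w a = k].
Proof. by rewrite hash_levelE -[X in measurable X]setTI; exact: mX. Qed.

Lemma measurable_hash_eq a a' : measurable [set w | g w a = g w a'].
Proof.
rewrite (_ : [set w | _] = [set w | X (inr a) w == X (inr a') w]).
  by apply: measurable_bool_set; exact: measurable_fun_eqr.
by apply/seteqP; split=> w /=; rewrite gE => /eqP.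
Qed.

(** Splitting along the value [k] of [g w a], independence turns each piece into [q] times the
    probability of [g w a = k]. *)
Lemma prob_hash_eq a a' : a != a' -> P [set w | g w a = g w a'] = q%:E.
Proof.
move=> aa'; rewrite -[RHS]mule1 -(@probability_setT _ _ _ P).
apply: (measure_partition_scale (Z := fun w => g w a)) => //.
- exact: measurable_hash_level.
- by rewrite invr_ge0.
- exact: measurable_hash_eq.
move=> k; rewrite setTI /= hg.
rewrite (_ : _ `&` _ = [set w | g w a = k] `&` [set w | g w a' = k]).
  have u : uniq ([:: inr a : gcws_index D] ++ [:: inr a' : gcws_index D]).
    by rewrite /= inE andbT; apply: contra aa' => /eqP[->].
  rewrite (independent_cylinders mX iX u) ?hg//;
    by apply: hash_level_cylinder; rewrite inE.
by apply/seteqP; split=> w /= [h1 h2]; split=> //; rewrite -?h1 ?h2// -h1.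
Qed.

Variables (p : R) (u v : 'I_D -> R).
Let samples := flatten (map (@block D) (enum 'I_(2 * D))).

Lemma samples_cylinder s o : <<s cylinders X samples >> [set w | sample X p s w = o].
Proof.
have h j i : i \in block j -> i \in samples.
  by move=> ij; apply/flattenP; exists (block j) => //; apply: map_f; rewrite mem_enum.
apply: (@measurable_gcws _ _ (g_sigma_algebraType (cylinders X samples))) => j;
  apply: measurable_fun_cylinders; apply: (h j); by rewrite !inE eqxx ?orbT.
Qed.

(** The outputs are measurable for the sampling variables, indexed by [inl], and the hash event for
    the two variables at [inr a] and [inr a']; the index lists are disjoint. *)
Lemma independent_samples_hash a a' o o' : a != a' ->
  P ([set w | sample X p u w = o /\ sample X p v w = o'] `&` [set w | g w a = g w a'])
  = (q%:E * P [set w | sample X p u w = o /\ sample X p v w = o'])%E.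
Proof.
move=> aa'.
have us : uniq (samples ++ [:: inr a; inr a']).
  rewrite cat_uniq uniq_blocks ?enum_uniq//= inE andbT.
  rewrite (_ : inr a == inr a' = false) ?andbT; last first.
    by apply/negbTE; apply: contra aa' => /eqP[->].
  by apply/norP; split; last apply/norP; try split=> //;
    apply/negP => /flattenP[_ /mapP[j _ ->]]; rewrite !inE.
rewrite (independent_cylinders mX iX us) ?prob_hash_eq ?(muleC (P _))//.
- apply: (@measurableI _ (g_sigma_algebraType (cylinders X samples)));
    exact: samples_cylinder.
rewrite (_ : [set w | _] = [set w | X (inr a) w == X (inr a') w]); last first.
  by apply/seteqP; split=> w /=; rewrite gE => /eqP.
apply: (@measurable_bool_set _ (g_sigma_algebraType (cylinders X [:: inr a; inr a']))).
by apply: measurable_fun_eqr; apply: measurable_fun_cylinders; rewrite !inE eqxx ?orbT.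
Qed.

Hypotheses (u0 : exists i, u i != 0) (v0 : exists i, v i != 0).

Lemma prob_hash_collision :
  P [set w | omap (g w) (sample X p u w) = omap (g w) (sample X p v w)] =
  (P [set w | sample X p u w = sample X p v w] +
   q%:E * P (~` [set w | sample X p u w = sample X p v w]))%E.
Proof.
set C := [set w | sample X p u w = sample X p v w].
set F := [set w | _].
have mC : measurable C by exact: measurable_collision.
pose Z w := (sample X p u w, sample X p v w).
have ZE z : [set w | Z w = z] =
    [set w | sample X p u w = z.1 /\ sample X p v w = z.2].
  by case: z => o o'; apply/seteqP; split=> w /= [h1 h2]; rewrite /Z ?h1 ?h2.
have mZ z : measurable [set w | Z w = z].
  by rewrite ZE; apply: measurableI; exact: measurable_sample.
(* A nonzero vector never yields [None], so a differing pair of outputs is a pair of genuine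
   arguments of [g]. *)
have noneu w : sample X p u w <> None.
  by have [i [+ _ _]] := gcws_argmin p (fun j => X (r_idx j) w) (fun j => X (c_idx j) w)
     (fun j => X (b_idx j) w) (sign_split_pos u0); rewrite /sample => ->.
have nonev w : sample X p v w <> None.
  by have [i [+ _ _]] := gcws_argmin p (fun j => X (r_idx j) w) (fun j => X (c_idx j) w)
     (fun j => X (b_idx j) w) (sign_split_pos v0); rewrite /sample => ->.
have cases z : (exists a a', [/\ a != a',
      F `&` ~` C `&` [set w | Z w = z] = [set w | Z w = z] `&` [set w | g w a = g w a'] &
      ~` C `&` [set w | Z w = z] = [set w | Z w = z]]) \/
    (F `&` ~` C `&` [set w | Z w = z] = set0 /\ ~` C `&` [set w | Z w = z] = set0).
  have [zz|/eqP zz] := eqVneq z.1 z.2.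
    right; suff h : ~` C `&` [set w | Z w = z] = set0 by rewrite -setIA h setI0.
    by apply/seteqP; split=> w //= [Cw wz]; apply: Cw; rewrite /C/=; move: zz; rewrite -wz.
  case: z zz => [[a|] o'] /= zz; last first.
    right; rewrite (_ : [set w | _] = set0) ?setI0//.
    by apply/seteqP; split=> w //= [/noneu].
  case: o' zz => [a'|] zz; last first.
    right; rewrite (_ : [set w | _] = set0) ?setI0//.
    by apply/seteqP; split=> w //= [_ /nonev].
  left; exists a, a'.
  have CE : ~` C `&` [set w | Z w = (Some a, Some a')] = [set w | Z w = (Some a, Some a')].
    apply/setIidr => w /= [wa wa'] /=; rewrite /C/= wa wa'; exact: zz.
  split=> //; first by apply/eqP => aa; apply: zz; rewrite aa.
  rewrite -setIA CE; apply/seteqP; split=> w /= [].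
    by move=> Fw [wa wa']; split; [rewrite /Z wa wa'|move: Fw; rewrite /F/= wa wa' => -[]].
  by move=> [wa wa'] gw; split; [rewrite /F/= wa wa'/= gw|rewrite /Z wa wa'].
(* As [g] is evaluated at random points, measurability is checked on each of the countably many
   pieces. *)
have mFC : measurable (F `&` ~` C).
  apply: (measurable_partition (Z := Z)) => z.
  have [[a [a' [_ -> _]]]|[-> _]//] := cases z.
  by apply: measurableI => //; exact: measurable_hash_eq.
have CF : C `<=` F by move=> w; rewrite /C /F/= => ->.
have -> : F = C `|` (F `&` ~` C).
  by rewrite -{1}(setIT F) -(setUv C) setIUr setIidr.
rewrite measureU//; last by rewrite setICA setICr setI0.
congr (_ + _)%E; apply: (measure_partition_scale (Z := Z)) => //.
- by rewrite invr_ge0.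
- exact: measurableC.
move=> z; have [[a [a' [aa' -> ->]]]|[-> ->]] := cases z.
  by rewrite ZE; exact: independent_samples_hash.
by rewrite measure0 mule0.
Qed.

End hashing.

Theorem theorem2 (R : realType) (D : nat) (p : R) (b : nat)
  (u v : 'I_D -> R)
  (d : measure_display) (T : measurableType d) (P : probability T R)
  (r c beta : 'I_(2 * D) -> T -> R)
  (g : T -> 'I_(2 * D) * int -> 'I_(2 ^ b)) :
  (1 <= D)%N -> 0 < p -> (1 <= b)%N ->
  (exists i, u i != 0) -> (exists i, v i != 0) ->
  (* all random quantities are measurable and mutually independent *)
  (forall k, measurable_fun setT (gcws_family r c beta g k)) ->
  mutually_independent P (gcws_family r c beta g) ->
  (* r_i, c_i ~ Gamma(2,1); beta_i ~ Uniform(0,1) *)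
  (forall j A, measurable A ->
     P (r j @^-1` A) = (\int[lebesgue_measure]_(x in A) (gamma21_pdf x)%:E)%E) ->
  (forall j A, measurable A ->
     P (c j @^-1` A) = (\int[lebesgue_measure]_(x in A) (gamma21_pdf x)%:E)%E) ->
  (forall j A, measurable A ->
     P (beta j @^-1` A) = uniform_prob (@ltr01 R) A) ->
  (* each g(x) is uniform on {0, ..., 2^b - 1} *)
  (forall x (k : 'I_(2 ^ b)),
     P [set w | g w x = k] = ((2 ^ b)%:R^-1 : R)%:E) ->
  P [set w | omap (g w) (gcws p u (fun j => r j w) (fun j => c j w)
                                   (fun j => beta j w))
           = omap (g w) (gcws p v (fun j => r j w) (fun j => c j w)
                                   (fun j => beta j w))]
  = (pGMM u v p + (2 ^ b)%:R^-1 * (1 - pGMM u v p))%:E.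
Proof.
move=> _ p0 _ u0 v0 mX iX lr lc lb hg.
have PC := prob_collision mX iX lr lc lb p0 u0 v0.
rewrite [LHS](prob_hash_collision mX iX hg p u0 v0) probability_setC; last first.
  exact: measurable_collision.
by rewrite PC.
Qed.
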